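(* Let $M$ be an oriented smooth hypersurface embedded in a Weitzenböck $(n+1)$-manifold $\tilde M$. Let $g\colon M\to\mathbb{S}^n$ be the Gauss map and let $\phi\colon TM\to g^*T\mathbb{S}^n$ be the identification. Then $$-\phi^{-1}\Delta g=\operatorname{div}(HI+2W^{\mathsf a})+\operatorname{tr}(WT)^\sharp,$$ $$-\phi^{-1}\Delta g=\overline{\operatorname{div}}(HI+2W^{\mathsf a})+\operatorname{tr}(WT)^\sharp-2W^{\mathsf a}(\operatorname{tr}T)^\sharp+\operatorname{tr}_MT(\cdot,W^{\mathsf a}\cdot),$$ $$-\phi^{-1}\bar\Delta g=\operatorname{div}(HI+2W^{\mathsf a})+\operatorname{tr}(WT)^\sharp+W(\operatorname{tr}T)^\sharp,$$ $$-\phi^{-1}\bar\Delta g=\overline{\operatorname{div}}(HI+2W^{\mathsf a})+\operatorname{tr}(WT)^\sharp+W^{\mathsf t}(\operatorname{tr}T)^\sharp+\operatorname{tr}_MT(\cdot,W^{\mathsf a}\cdot),$$ where a bar denotes a quantity associated with the Levi-Civita connection on $M$. In particular, if $M$ is torsion-free, $-\phi^{-1}\Delta g=\operatorname{div}(HI+2W^{\mathsf a})$.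
   Context: A Weitzenböck $(n+1)$-manifold $\tilde M$ is a smooth $(n+1)$-manifold with a fixed global smooth frame $(\tilde E_1,\dots,\tilde E_{n+1})$, equipped with the orientation and the metric making this frame oriented orthonormal, and with the metric-compatible flat connection $\tilde\nabla$ determined by $\tilde\nabla\tilde E_i=0$ for all $i$. An oriented smooth hypersurface $M\subset\tilde M$ carries the restricted metric $\langle\cdot,\cdot\rangle$ and the projected metric-compatible connection $\nabla_XY=(\tilde\nabla_XY)^\top$ (tangential part), with torsion $T(X,Y)=\nabla_XY-\nabla_YX-[X,Y]$; $M$ is torsion-free if $T=0$ everywhere. $\bar\nabla$ is the Levi-Civita connection of the induced metric on $M$. $N$ is the unit normal vector field along $M$ such that a frame $(E_1,\dots,E_n)$ of $M$ is oriented iff $(N,E_1,\dots,E_n)$ is oriented in $\tilde M$. The Weingarten map $W$ is the $(1,1)$-tensor field on $M$ with $\langle WX,Y\rangle=\langle N,\tilde\nabla_XY\rangle$ (not necessarily symmetric); $W^{\mathsf t}$ is its adjoint, $W^{\mathsf a}=\frac12(W-W^{\mathsf t})$, $H=\operatorname{tr}W$, and $I$ is the identity operator. For a $(1,2)$-tensor field $P$ on $M$, $\operatorname{tr}P$ is the $1$-form $(\operatorname{tr}P)(X)=\operatorname{tr}(P(X,\cdot))$; $WT$ is the $(1,2)$-tensor field $(X,Y)\mapsto W(T(X,Y))$; $\operatorname{tr}_MT(\cdot,W^{\mathsf a}\cdot)=\sum_iT(E_i,W^{\mathsf a}E_i)$ for a local orthonormal frame $(E_i)$ of $M$; $\sharp$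 is the metric dual. For a $(1,1)$-tensor field $A$, $\operatorname{div}A=\sum_i(\nabla_{E_i}A)E_i$ and $\overline{\operatorname{div}}A=\sum_i(\bar\nabla_{E_i}A)E_i$. Gauss map: writing $N=\sum_iN^i\tilde E_i$, $g=(N^1,\dots,N^{n+1})\colon M\to\mathbb{S}^n$. Identification: for $p\in M$ the linear isometry $\phi\colon T_p\tilde M\to\mathbb{R}^{n+1}$ sending a vector to its coefficient vector relative to $(\tilde E_i|_p)$ sends $N|_p$ to $g(p)$ and restricts to an isometry $T_pM\to T_{g(p)}\mathbb{S}^n$; this gives a vector bundle isomorphism $\phi\colon TM\to g^*T\mathbb{S}^n$. Laplacians: $\Delta g=\sum_i\big[(g^*\nabla^{\mathbb{S}^n})_{E_i}(\mathrm{d}g(E_i))-\mathrm{d}g(\nabla_{E_i}E_i)\big]$, where $\nabla^{\mathbb{S}^n}$ is the Levi-Civita connection of the round metric; $\bar\Delta g$ is the same expression with $\bar\nabla$ in place of $\nabla$. *)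

(* Defs.v *)
From HB Require Import structures.
From mathcomp Require Import all_boot all_order all_algebra.
From mathcomp Require Import all_classical all_reals all_analysis.
Import Order.TTheory GRing.Theory Num.Theory.
Import numFieldNormedType.Exports.

Set Implicit Arguments.
Unset Strict Implicit.
Unset Printing Implicit Defensive.

Local Open Scope classical_set_scope.
Local Open Scope ring_scope.

Section Smoothness.
Context {R : realType} {m : nat} {V : normedModType R}.

Fixpoint Ck (k : nat) (U : set 'rV[R]_m) (f : 'rV[R]_m -> V) : Prop :=
  match k with
  | 0 => forall x, U x -> {for x, continuous f}
  | k'.+1 => (forall x, U x -> differentiable f x) /\
             (forall v, Ck k' U (fun x => 'D_v f x))
  end.

Definition smooth_on (U : set 'rV[R]_m) (f : 'rV[R]_m -> V) : Prop :=
  forall k, Ck k U f.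

End Smoothness.

Definition dot {R : realType} {k : nat} (x y : 'rV[R]_k) : R :=
  (x *m y^T) ord0 ord0.

(* A chart [c] is a triple of its domain, its coordinate map and its inverse
   [chart_param c]; the last two are total functions whose values are irrelevant
   outside [chart_dom c] and [chart_coord c @` chart_dom c].  Besides an atlas
   we fix a preferred chart around each point, which only serves to name tangent
   vectors. *)
Record manifold (R : realType) (m : nat) := Manifold {
  points :> topologicalType;
  manifold_hausdorff : hausdorff_space points;
  manifold_second_countable : @second_countable points;
  chart : Type;
  chart_dom : chart -> set points;
  chart_coord : chart -> points -> 'rV[R]_m;
  chart_param : chart -> 'rV[R]_m -> points;
  chart_dom_open : forall c, open (chart_dom c);
  chart_codom_open : forall c, open (chart_coord c @` chart_dom c);
  chart_coordK : forall c p,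
    chart_dom c p -> chart_param c (chart_coord c p) = p;
  chart_coord_continuous : forall c p,
    chart_dom c p -> {for p, continuous (chart_coord c)};
  chart_param_continuous : forall c x,
    (chart_coord c @` chart_dom c) x -> {for x, continuous (chart_param c)};
  transition_smooth : forall c d,
    smooth_on (chart_coord c @` (chart_dom c `&` chart_dom d))
              (chart_coord d \o chart_param c);
  chart_at : points -> chart;
  chart_at_dom : forall p, chart_dom (chart_at p) p
}.

(* The tangent space of an m-manifold at p is ['rV[R]_m]: the vector v stands
   for the tangent vector at p whose components in the preferred chart
   [chart_at p] are v.  Thus a vector field, or a section of the pullback of a
   tangent bundle, is a plain function into row vectors, whose smoothness has
   to be tested after passing to the components in a fixed chart ([components]).
   A linear map between tangent spaces is a matrix acting on the right,
   v |-> v *m A, so that composites are written in reverse order. *)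

Section Tangent.
Context {R : realType} {m : nat} {M : manifold R m}.

Definition smooth_fun {V : normedModType R} (U : set M) (f : M -> V) : Prop :=
  forall c : chart M,
    smooth_on (chart_coord c @` (chart_dom c `&` U)) (f \o chart_param c).

(* The derivative v(f) of a vector-valued function at p along v in T_pM. *)
Definition der {V : normedModType R} (f : M -> V) (p : M) (v : 'rV[R]_m) : V :=
  'D_v (f \o chart_param (chart_at p)) (chart_coord (chart_at p) p).

Definition components (c : chart M) (p : M) (v : 'rV[R]_m) : 'rV[R]_m :=
  der (chart_coord c) p v.

End Tangent.

Section Maps.
Context {R : realType} {m k : nat} {M : manifold R m} {P : manifold R k}.
Variable F : M -> P.

Definition smooth_map : Prop :=
  continuous F /\
  forall (c : chart M) (d : chart P),
    smooth_on (chart_coord c @` (chart_dom c `&` F @^-1` chart_dom d))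
              (chart_coord d \o F \o chart_param c).

Definition tangent_map (p : M) (v : 'rV[R]_m) : 'rV[R]_k :=
  der (chart_coord (chart_at (F p)) \o F) p v.

(* Smoothness on U of a section s of F^*TP, i.e., s p is in T_{F p}P. *)
Definition smooth_section (U : set M) (s : M -> 'rV[R]_k) : Prop :=
  forall (c : chart M) (d : chart P),
    smooth_on (chart_coord c @` (chart_dom c `&` U `&` F @^-1` chart_dom d))
              (fun x => components d (F (chart_param c x))
                                     (s (chart_param c x))).

Definition section_near (p : M) (s : M -> 'rV[R]_k) : Prop :=
  exists2 U, open_nbhs p U & smooth_section U s.

End Maps.

(* What a smooth map F with differential dF, valued in a manifold or in a vector
   space, must satisfy to be an embedding: it is an injective immersion and a
   homeomorphism onto its image. *)
Definition embedding_of {R : realType} {m : nat} {M : manifold R m}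
    {P : topologicalType} {V : normedModType R}
    (F : M -> P) (dF : M -> 'rV[R]_m -> V) : Prop :=
  [/\ injective F,
      forall p v, dF p v = 0 -> v = 0 &
      forall U : set M, open U -> exists2 O, open O & U = F @^-1` O].

Section VectorFields.
Context {R : realType} {m : nat} {M : manifold R m}.

Definition vector_field (U : set M) (X : M -> 'rV[R]_m) : Prop :=
  smooth_section (@idfun M) U X.

Definition field_near (p : M) (X : M -> 'rV[R]_m) : Prop :=
  section_near (@idfun M) p X.

Definition fun_near (p : M) (f : M -> R) : Prop :=
  exists2 U, open_nbhs p U & smooth_fun U f.

(* [X, Y]^k = X(Y^k) - Y(X^k), computed in the preferred chart at p. *)
Definition lie (X Y : M -> 'rV[R]_m) (p : M) : 'rV[R]_m :=
  let c := chart_at p in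
  der (fun q => components c q (Y q)) p (X p)
  - der (fun q => components c q (X q)) p (Y p).

(* [pos p B]: the rows of B form an oriented basis of T_pM. *)
Definition orientation (pos : M -> 'M[R]_m -> bool) : Prop :=
  [/\ forall p B, pos p B -> B \in unitmx,
      forall p B C, B \in unitmx -> C \in unitmx ->
        (pos p B == pos p C) = (0 < \det (B *m invmx C)) &
      forall (U : set M) (X : 'I_m -> M -> 'rV[R]_m),
        open U -> (forall i, vector_field U (X i)) ->
        (forall q, U q -> \matrix_i X i q \in unitmx) ->
        forall p, U p ->
          \forall q \near p, pos q (\matrix_i X i q) = pos p (\matrix_i X i p)].

End VectorFields.

Section Connections.
Context {R : realType} {m : nat} {M : manifold R m}.

(* A connection on F^*TP; [D s p v] is D_v s at p, only meaningful for sections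
   s that are smooth near p.  Locality in s follows from the Leibniz rule, since
   functions and sections need only be smooth near p. *)
Definition connection_along {k : nat} {P : manifold R k} (F : M -> P)
    (D : (M -> 'rV[R]_k) -> M -> 'rV[R]_m -> 'rV[R]_k) : Prop :=
  [/\ forall s p, section_near F p s -> linear (D s p),
      forall s t p v, section_near F p s -> section_near F p t ->
        D (fun q => s q + t q) p v = D s p v + D t p v,
      forall f s p v, fun_near p f -> section_near F p s ->
        D (fun q => f q *: s q) p v = der f p v *: s p + f p *: D s p v &
      forall (U : set M) s X, open U ->
        smooth_section F U s -> vector_field U X ->
        smooth_section F U (fun q => D s q (X q))].

Definition connection (D : (M -> 'rV[R]_m) -> M -> 'rV[R]_m -> 'rV[R]_m) :
  Prop := connection_along (@idfun M) D.

Definition torsion (D : (M -> 'rV[R]_m) -> M -> 'rV[R]_m -> 'rV[R]_m)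
    (X Y : M -> 'rV[R]_m) (p : M) : 'rV[R]_m :=
  D Y p (X p) - D X p (Y p) - lie X Y p.

Definition levi_civita (met : M -> 'rV[R]_m -> 'rV[R]_m -> R)
    (D : (M -> 'rV[R]_m) -> M -> 'rV[R]_m -> 'rV[R]_m) : Prop :=
  [/\ connection D,
      forall X Y p v, field_near p X -> field_near p Y ->
        der (fun q => met q (X q) (Y q)) p v
        = met p (D X p v) (Y p) + met p (X p) (D Y p v) &
      forall X Y p, field_near p X -> field_near p Y -> torsion D X Y p = 0].

Definition pullback_connection {k : nat} {P : manifold R k} (F : M -> P)
    (D : (P -> 'rV[R]_k) -> P -> 'rV[R]_k -> 'rV[R]_k)
    (DF : (M -> 'rV[R]_k) -> M -> 'rV[R]_m -> 'rV[R]_k) : Prop :=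
  connection_along F DF /\
  forall Z p v, field_near (F p) Z ->
    DF (Z \o F) p v = D Z (F p) (tangent_map F p v).

End Connections.

Section Tensors.
Context {R : realType} {m : nat} {M : manifold R m}.
Variable met : M -> 'rV[R]_m -> 'rV[R]_m -> R.

Definition tensor11 (A : M -> 'M[R]_m) : Prop :=
  forall (U : set M) X, open U -> vector_field U X ->
    vector_field U (fun q => X q *m A q).

Definition tensor12 (P : M -> 'rV[R]_m -> 'rV[R]_m -> 'rV[R]_m) : Prop :=
  [/\ forall p x, linear (P p x), forall p y, linear (P p ^~ y) &
      forall (U : set M) X Y, open U -> vector_field U X -> vector_field U Y ->
        vector_field U (fun q => P q (X q) (Y q))].

Definition gram (p : M) : 'M[R]_m :=
  \matrix_(i, j) met p (delta_mx ord0 i) (delta_mx ord0 j).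

(* The vector u of T_pM such that <u, x> = a x for all x. *)
Definition sharp (p : M) (a : 'rV[R]_m -> R) : 'rV[R]_m :=
  (\row_i a (delta_mx ord0 i)) *m invmx (gram p).

(* The matrix A' such that <x *m A, y> = <x, y *m A'>. *)
Definition adjoint (p : M) (A : 'M[R]_m) : 'M[R]_m :=
  gram p *m A^T *m invmx (gram p).

Definition tr12 (P : 'rV[R]_m -> 'rV[R]_m -> 'rV[R]_m) (x : 'rV[R]_m) : R :=
  \tr (lin1_mx (P x)).

Definition orthonormal_frame (U : set M) (E : 'I_m -> M -> 'rV[R]_m) : Prop :=
  (forall i, vector_field U (E i)) /\
  (forall p, U p -> forall i j, met p (E i p) (E j p) = (i == j)%:R).

Variable E : 'I_m -> M -> 'rV[R]_m.

(* sum_i (D_{E_i} A) E_i, where (D_X A) Y = D_X (A Y) - A (D_X Y). *)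
Definition divergence (D : (M -> 'rV[R]_m) -> M -> 'rV[R]_m -> 'rV[R]_m)
    (A : M -> 'M[R]_m) (p : M) : 'rV[R]_m :=
  \sum_i (D (fun q => E i q *m A q) p (E i p) - D (E i) p (E i p) *m A p).

(* sum_i (DF_{E_i} (dF (E_i)) - dF (D_{E_i} E_i)) for a map F : M -> P and a
   connection DF on F^*TP. *)
Definition laplacian {k : nat} {P : manifold R k} (F : M -> P)
    (DF : (M -> 'rV[R]_k) -> M -> 'rV[R]_m -> 'rV[R]_k)
    (D : (M -> 'rV[R]_m) -> M -> 'rV[R]_m -> 'rV[R]_m) (p : M) : 'rV[R]_k :=
  \sum_i (DF (fun q => tangent_map F q (E i q)) p (E i p)
          - tangent_map F p (D (E i) p (E i p))).

End Tensors.

(* The unit sphere S^n of R^(n+1) with its structure of embedded submanifold,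
   as an abstract manifold with an inclusion; this determines it up to a unique
   diffeomorphism compatible with the inclusions. *)
Record sphere (R : realType) (n : nat) := Sphere {
  sphere_manifold :> manifold R n;
  sphere_incl : sphere_manifold -> 'rV[R]_n.+1;
  sphere_incl_smooth : smooth_fun setT sphere_incl;
  sphere_incl_embedding : embedding_of sphere_incl (der sphere_incl);
  sphere_incl_range : range sphere_incl = [set x | dot x x = 1]
}.

Definition round_metric {R : realType} {n : nat} (S : sphere R n) (x : S)
    (u v : 'rV[R]_n) : R :=
  dot (der (@sphere_incl R n S) x u) (der (@sphere_incl R n S) x v).

Record weitzenbock (R : realType) (n : nat) := Weitzenbock {
  weitzenbock_manifold :> manifold R n.+1;
  frame : 'I_n.+1 -> weitzenbock_manifold -> 'rV[R]_n.+1;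
  frame_smooth : forall i, vector_field setT (frame i);
  frame_basis : forall q, \matrix_i frame i q \in unitmx
}.

Section Weitzenbock.
Context {R : realType} {n : nat} {Mt : weitzenbock R n}.

Definition frame_mx (q : Mt) : 'M[R]_n.+1 := \matrix_i frame i q.

(* The coefficient vector of v in T_qMt relative to the frame. *)
Definition coef (q : Mt) (v : 'rV[R]_n.+1) : 'rV[R]_n.+1 :=
  v *m invmx (frame_mx q).

Definition wmetric (q : Mt) (u v : 'rV[R]_n.+1) : R :=
  dot (coef q u) (coef q v).

Definition woriented (q : Mt) (B : 'M[R]_n.+1) : bool :=
  0 < \det (B *m invmx (frame_mx q)).

(* The derivative along v, with respect to the flat connection for which the
   frame is parallel, of a section s of F^*TMt. *)
Definition wnabla {m : nat} {M : manifold R m} (F : M -> Mt)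
    (s : M -> 'rV[R]_n.+1) (p : M) (v : 'rV[R]_m) : 'rV[R]_n.+1 :=
  der (fun q => coef (F q) (s q)) p v *m frame_mx (F p).

End Weitzenbock.

Record hypersurface (R : realType) (n : nat) (Mt : weitzenbock R n) :=
  Hypersurface {
  hypersurface_manifold :> manifold R n;
  incl : hypersurface_manifold -> Mt;
  incl_smooth : smooth_map incl;
  incl_embedding : embedding_of incl (tangent_map incl);
  oriented : hypersurface_manifold -> 'M[R]_n -> bool;
  oriented_orientation : orientation oriented
}.

Section Hypersurface.
Context {R : realType} {n : nat} {Mt : weitzenbock R n} {M : hypersurface Mt}.

Local Notation iota := (@incl R n Mt M).
Local Notation diota := (tangent_map iota).

Definition hmetric (p : M) (u v : 'rV[R]_n) : R :=
  wmetric (iota p) (diota p u) (diota p v).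

(* The tangential part of w in T_pMt, i.e., the vector u of T_pM such that
   <u, x> = <w, x> for all x in T_pM. *)
Definition tangential (p : M) (w : 'rV[R]_n.+1) : 'rV[R]_n :=
  sharp hmetric p (fun x => wmetric (iota p) w (diota p x)).

Definition nabla (Y : M -> 'rV[R]_n) (p : M) (v : 'rV[R]_n) : 'rV[R]_n :=
  tangential p (wnabla iota (fun q => diota q (Y q)) p v).

Definition unit_normal (N : M -> 'rV[R]_n.+1) : Prop :=
  [/\ smooth_section iota setT N,
      forall p, wmetric (iota p) (N p) (N p) = 1,
      forall p v, wmetric (iota p) (N p) (diota p v) = 0 &
      forall p (B : 'M[R]_n), B \in unitmx ->
        oriented p B =
        woriented (iota p)
          (col_mx (N p) (\matrix_i diota p (row i B)) : 'M[R]_(1 + n))].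

Definition weingarten (N : M -> 'rV[R]_n.+1) (W : M -> 'M[R]_n) : Prop :=
  tensor11 W /\
  forall Y p x, field_near p Y ->
    hmetric p (x *m W p) (Y p) =
    wmetric (iota p) (N p) (wnabla iota (fun q => diota q (Y q)) p x).

Definition torsion_tensor (T : M -> 'rV[R]_n -> 'rV[R]_n -> 'rV[R]_n) : Prop :=
  tensor12 T /\
  forall X Y p, field_near p X -> field_near p Y ->
    T p (X p) (Y p) = torsion nabla X Y p.

Definition gauss_map {S : sphere R n} (N : M -> 'rV[R]_n.+1) (g : M -> S) :
  Prop :=
  smooth_map g /\ forall p, sphere_incl (g p) = coef (iota p) (N p).

(* [phi p] is the matrix of the isomorphism from T_pM to T_{g p}S^n obtained by
   restricting v |-> coef (iota p) v, where T_{g p}S^n is seen in R^(n+1). *)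
Definition identification {S : sphere R n} (g : M -> S) (phi : M -> 'M[R]_n) :
  Prop :=
  forall p v, der (@sphere_incl R n S) (g p) (v *m phi p) =
              coef (iota p) (diota p v).

(* W^a = (W - W^t) / 2. *)
Definition skew_part (p : M) (A : 'M[R]_n) : 'M[R]_n :=
  2^-1 *: (A - adjoint hmetric p A).

End Hypersurface.

(* Main.v *)
Require Import Defs.
From HB Require Import structures.
From mathcomp Require Import all_boot all_order all_algebra.
From mathcomp Require Import all_classical all_reals all_analysis.
From mathcomp Require Import ring lra.
Import Order.TTheory GRing.Theory Num.Theory.
Import numFieldNormedType.Exports.
Set Implicit Arguments.
Unset Strict Implicit.
Unset Printing Implicit Defensive.
Local Open Scope classical_set_scope.
Local Open Scope ring_scope.

(** The parallel frame identifies every tangent space of the ambient manifold with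
    a Euclidean space, in which the flat connection is the ordinary derivative and
    the normal [N] becomes the Gauss map. The theorem follows from three facts.

    First, since [<N, Y> = 0] and [<N, N> = 1], the derivative of the Gauss map is
    [dg = - phi W] ([der_normal_coef], [tangent_map_gauss]). Both [nabla] and the
    pullback of the Levi-Civita connection of the sphere are tangential parts of the
    derivative in the Euclidean space, over tangent spaces that [phi] identifies, so
    [phi] carries one to the other. For the sphere this is the uniqueness of the
    Levi-Civita connection, checked on coordinate fields
    ([levi_civita_coord_field]) and transported along the map
    ([pullback_levi_civita]). Hence minus the Laplacian corresponds to the sum of
    the [nabla_{E_i} (W E_i) - W (D_{E_i} E_i)], where [D] is the connection used on
    the hypersurface ([laplacian_gauss]); for [D = nabla] this is [div W].

    Second, the second derivatives of [N] are symmetric, which gives the Codazzi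
    equation [(nabla_X W) Y - (nabla_Y W) X + W T(X, Y) = 0] ([codazzi]). Tracing it
    gives [div W^t = grad H + tr(WT)^sharp], and as [W = 2 W^a + W^t], this is the
    first formula ([frame_div_shape]).

    Third, [nabla] and the Levi-Civita connection are both metric, so their
    difference is skew, and antisymmetrizing it in its two arguments gives the
    torsion. Therefore the sum of the differences of [D_{E_i} E_i] is [(tr T)^sharp]
    ([frame_trTE]), and the two divergences of [HI + 2 W^a] differ by torsion terms
    ([frame_div_shape_change]); this gives the other formulas.

    The last two steps are computations with the matrices of the connections and of
    [W] in the orthonormal frame. They require that the entries of these matrices be
    smooth, whence the calculus of [Ck] maps. *)

(** * Calculus of C^k maps on coordinate spaces *)

Section NearDiff.
Context {R : realType} {V W : normedModType R}.
Implicit Types f g : V -> W.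

Lemma near_eq_differentiable f g x :
  (\near x, f x = g x) -> differentiable f x -> differentiable g x.
Proof.
move=> fg /diff_locallyP[dfc df].
have fgx : f x = g x by exact: (nbhs_singleton fg).
have dg : g \o shift x = cst (g x) + 'd f x +o_ 0 id.
  apply/eqaddoP => e e0; move/eqaddoP : df => /(_ e e0) df.
  have fg0 : \forall y \near (0 : V), f (y + x) = g (y + x).
    have := fg; rewrite (near_shift 0) /=.
    by apply: filterS => y; rewrite subr0.
  by apply: filterS2 fg0 df => y fgy; rewrite !fctE /= fgy fgx.
by apply/diff_locallyP; rewrite (diff_unique dfc dg).
Qed.

End NearDiff.

Section CkAlgebra.
Context {R : realType} {m : nat}.
Implicit Types (U : set 'rV[R]_m) (k : nat).

Lemma open_near U (P : 'rV[R]_m -> Prop) x :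
  open U -> U x -> (forall y, U y -> P y) -> \near x, P x.
Proof.
by move=> oU Ux UP; apply: filterS UP _; exact: open_nbhs_nbhs.
Qed.

(** On an open set the derivatives only depend on the values on that set. *)
Lemma Ck_eq {V : normedModType R} k U (f g : 'rV[R]_m -> V) : open U ->
  (forall x, U x -> f x = g x) -> Ck k U f -> Ck k U g.
Proof.
move=> oU; elim: k f g => [|k IH] f g fg /=.
  move=> cf x Ux; have nfg := open_near oU Ux fg.
  have cfx : f @ x --> g x by rewrite -(fg x Ux); exact: cf.
  exact: cvg_trans (near_eq_cvg nfg) cfx.
move=> [df Df]; split=> [x Ux|v].
  by apply: near_eq_differentiable (df _ Ux); exact: (open_near oU Ux fg).
apply: IH (Df v) => x Ux; apply: near_eq_derive.
exact: (open_near oU Ux fg).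
Qed.

Lemma Ck_sub {V : normedModType R} k U U' (f : 'rV[R]_m -> V) :
  U' `<=` U -> Ck k U f -> Ck k U' f.
Proof.
move=> sU; elim: k f => [|k IH] f /=; first by move=> cf x /sU; exact: cf.
by move=> [df Df]; split=> [x /sU|v]; [exact: df | exact: IH].
Qed.

Lemma CkW {V : normedModType R} k U (f : 'rV[R]_m -> V) :
  Ck k.+1 U f -> Ck k U f.
Proof.
elim: k f => [|k IH] f.
  by move=> [df _] x Ux; exact/differentiable_continuous/df.
by move=> [df Df]; split=> // v; exact: IH.
Qed.

Lemma Ck_cst {V : normedModType R} k U (a : V) : open U -> Ck k U (fun=> a).
Proof.
move=> oU; elim: k a => [|k IH] a /=; first by move=> x _; apply: cst_continuous.
split=> [x _|v]; first exact: differentiable_cst.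
by apply: (Ck_eq (f := fun=> 0)) => // x _; rewrite derive_cst.
Qed.

Lemma CkD {V : normedModType R} k U (f g : 'rV[R]_m -> V) : open U ->
  Ck k U f -> Ck k U g -> Ck k U (fun x => f x + g x).
Proof.
move=> oU; elim: k f g => [|k IH] f g /=.
  by move=> cf cg x Ux; apply: continuousD; [exact: (cf x Ux)|exact: (cg x Ux)].
move=> [df Df] [dg Dg]; split=> [x Ux|v].
  by apply: differentiableD; [exact: df|exact: dg].
apply: (Ck_eq (f := fun x => 'D_v f x + 'D_v g x)) (IH _ _ (Df v) (Dg v)) => //.
move=> x Ux; rewrite -deriveD //; apply: diff_derivable.
  exact: df.
exact: dg.
Qed.

(** The Leibniz formula, by induction on the order; [CkV] is the same for the inverse. *)
Lemma CkM k U (f g : 'rV[R]_m -> R) : open U ->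
  Ck k U f -> Ck k U g -> Ck k U (fun x => f x * g x).
Proof.
move=> oU; elim: k f g => [|k IH] f g.
  by move=> cf cg x Ux; apply: continuousM; [exact: (cf x Ux)|exact: (cg x Ux)].
move=> hf hg; have [/= df Df] := hf; have [/= dg Dg] := hg.
split=> [x Ux|v].
  by apply: differentiableM; [exact: df|exact: dg].
apply: (Ck_eq (f := fun x => f x * 'D_v g x + g x * 'D_v f x)) => //.
  move=> x Ux; have fx : derivable f x v by exact/diff_derivable/df.
  have gx : derivable g x v by exact/diff_derivable/dg.
  exact/esym/(deriveM fx gx).
apply: CkD => //; apply: IH; [exact: CkW|exact: Dg|exact: CkW|exact: Df].
Qed.

Lemma CkV k U (f : 'rV[R]_m -> R) : open U -> (forall x, U x -> f x != 0) ->
  Ck k U f -> Ck k U (fun x => (f x)^-1).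
Proof.
move=> oU f0; elim: k => [|k IH].
  by move=> cf x Ux; apply: continuousV; [exact: f0|exact: (cf x Ux)].
move=> hf; have [/= df Df] := hf.
split=> [x Ux|v].
  by apply: differentiableV; [exact: df|exact: f0].
apply: (Ck_eq (f := fun x => (- 1 * ((f x)^-1 * (f x)^-1)) * 'D_v f x)) => //.
  move=> x Ux.
  have -> : 'D_v (fun x => (f x)^-1) x = - (f x) ^- 2 *: 'D_v f x.
    by apply: deriveV; [exact: f0|exact/diff_derivable/df].
  by rewrite mulN1r expr2 invfM.
have Vk : Ck k U (fun x => (f x)^-1) by apply: IH; exact: CkW.
apply: CkM (Df v) => //; apply: CkM (CkM oU Vk Vk) => //; exact: Ck_cst.
Qed.

Lemma Ck_sum {V : normedModType R} (I : Type) (r : seq I) (P : pred I) k U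
    (f : I -> 'rV[R]_m -> V) : open U -> (forall i, P i -> Ck k U (f i)) ->
  Ck k U (fun x => \sum_(i <- r | P i) f i x).
Proof.
move=> oU hf; elim: r => [|i r IH].
  by apply: (Ck_eq (f := fun=> 0)) (Ck_cst _ _ _) => // x _; rewrite big_nil.
case Pi: (P i); last first.
  by apply: Ck_eq IH => // x _; rewrite big_cons Pi.
apply: (Ck_eq (f := fun x => f i x + \sum_(i <- r | P i) f i x)) => //.
  by move=> x _; rewrite big_cons Pi.
by apply: CkD => //; exact: hf.
Qed.

Lemma Ck_prod (I : Type) (r : seq I) (P : pred I) k U
    (f : I -> 'rV[R]_m -> R) : open U -> (forall i, P i -> Ck k U (f i)) ->
  Ck k U (fun x => \prod_(i <- r | P i) f i x).
Proof.
move=> oU hf; elim: r => [|i r IH].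
  apply: (Ck_eq (V := R) (f := fun=> 1)) => //; last exact: Ck_cst.
  by move=> x _; rewrite big_nil.
case Pi: (P i); last first.
  by apply: Ck_eq IH => // x _; rewrite big_cons Pi.
apply: (Ck_eq (V := R) (f := fun x => f i x * \prod_(i <- r | P i) f i x)) => //.
  by move=> x _; rewrite big_cons Pi.
by apply: CkM => //; exact: hf.
Qed.

End CkAlgebra.

Lemma linear_fun0 {R : realType} {a b : nat} (L : 'rV[R]_a -> 'rV[R]_b) :
  linear L -> L 0 = 0.
Proof. by move=> lL; have := lL (-1) 0 0; rewrite scaler0 addr0 scaleN1r addNr. Qed.

Lemma linear_fun_sum {R : realType} {a b : nat} (L : 'rV[R]_a -> 'rV[R]_b)
    (I : Type) (r : seq I) (c : I -> R) (u : I -> 'rV[R]_a) : linear L ->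
  L (\sum_(i <- r) c i *: u i) = \sum_(i <- r) c i *: L (u i).
Proof.
move=> lL; elim: r => [|i r IH]; first by rewrite !big_nil linear_fun0.
by rewrite !big_cons lL IH.
Qed.

Section DirectionalDerivative.
Context {R : realType} {V W X : normedModType R}.

Lemma derive_chain (h : V -> W) (f : W -> X) x v :
  differentiable h x -> differentiable f (h x) ->
  'D_v (f \o h) x = 'D_('D_v h x) f (h x).
Proof.
move=> dh df; rewrite !deriveE //; last exact: differentiable_comp.
by rewrite diff_comp.
Qed.

Lemma derive_linear (f : V -> W) x :
  differentiable f x -> linear (fun v => 'D_v f x).
Proof. by move=> df a u v; rewrite !deriveE // linearP. Qed.

Lemma is_derive_diff (f : V -> W) x v : differentiable f x ->
  is_derive x v f ('D_v f x).
Proof. by move=> df; exact/derivableP/diff_derivable. Qed.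

End DirectionalDerivative.

(** Expanding directions in the canonical basis turns derivatives along a varying
    direction into combinations of derivatives along fixed ones, the only ones that
    [Ck] speaks of. *)
Lemma derive_delta {R : realType} {m : nat} {V : normedModType R}
    (f : 'rV[R]_m -> V) x v : differentiable f x ->
  'D_v f x = \sum_a v 0 a *: 'D_(delta_mx 0 a) f x.
Proof.
move=> df; rewrite deriveE // {1}[v]row_sum_delta linear_sum.
by apply: eq_bigr => a _; rewrite linearZ deriveE.
Qed.

Section MatrixValued.
Context {R : realType} {V : normedModType R} {a b : nat}.
Implicit Types M : V -> 'M[R]_(a, b).

Lemma derive_mxE M x v i j : derivable M x v ->
  ('D_v M x) i j = 'D_v (fun y => M y i j) x.
Proof. by move=> dM; rewrite derive_mx // mxE. Qed.

Lemma is_derive_mx M x v (D : 'M[R]_(a, b)) :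
  (forall i j, is_derive x v (fun y => M y i j : R) (D i j)) ->
  is_derive x v M D.
Proof.
move=> dM; have dMx : derivable M x v.
  by apply/derivable_mxP => i j; have [] := dM i j.
apply: DeriveDef => //; apply/matrixP => i j.
by rewrite derive_mxE //; have [_ ->] := dM i j.
Qed.

Lemma is_derive_mx_entry M x v (D : 'M[R]_(a, b)) i j :
  is_derive x v M D -> is_derive x v (fun y => M y i j : R) (D i j).
Proof.
move=> [dM <-]; apply: DeriveDef; last by rewrite derive_mxE.
by move/derivable_mxP : dM.
Qed.

Lemma mx_delta_sum M : M = fun x => \sum_i \sum_j M x i j *: delta_mx i j.
Proof. by apply/funext => x; rewrite -matrix_sum_delta. Qed.

Lemma differentiable_mxP M x :
  differentiable M x <-> forall i j, differentiable (fun y => M y i j : R) x.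
Proof.
split=> [dM i j|dM].
  have := differentiable_comp dM (@differentiable_coord R a b (M x) i j).
  by [].
rewrite (mx_delta_sum M).
have -> : (fun x => \sum_i \sum_j M x i j *: delta_mx i j) =
    \sum_i \sum_j (fun x => M x i j *: (delta_mx i j : 'M[R]_(a, b))).
  by apply/funext => y; rewrite fct_sumE; apply: eq_bigr => i _; rewrite fct_sumE.
by apply: differentiable_sum => i; apply: differentiable_sum => j;
  exact: differentiableZl.
Qed.

End MatrixValued.

Lemma is_derive_mulmx {R : realType} {V : normedModType R} {a b c : nat}
    (M : V -> 'M[R]_(a, b)) (P : V -> 'M[R]_(b, c)) x v dM dP :
  is_derive x v M dM -> is_derive x v P dP ->
  is_derive x v (fun y => M y *m P y) (dM *m P x + M x *m dP).
Proof.
move=> hM hP; apply: is_derive_mx => i j.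
have -> : (fun y => (M y *m P y) i j) =
    \sum_k ((fun y => M y i k : R) * (fun y => P y k j : R)).
  by apply/funext => y; rewrite mxE fct_sumE.
apply: is_derive_eq.
  apply: is_derive_sum => k.
  by apply: is_deriveM; exact: is_derive_mx_entry.
rewrite !mxE -big_split /=; apply: eq_bigr => k _.
by rewrite addrC; congr (_ + _); rewrite mulrC.
Qed.

Lemma is_derive_scale {R : realType} {V : normedModType R} {a b : nat}
    (f : V -> R) (M : V -> 'M[R]_(a, b)) x v df dM :
  is_derive x v f df -> is_derive x v M dM ->
  is_derive x v (fun y => f y *: M y) (df *: M x + f x *: dM).
Proof.
move=> hf hM; apply: is_derive_mx => i j.
have -> : (fun y => (f y *: M y) i j) = f * (fun y => M y i j : R).
  by apply/funext => y; rewrite mxE.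
apply: is_derive_eq.
  by apply: is_deriveM; exact: is_derive_mx_entry.
by rewrite !mxE addrC; congr (_ + _); rewrite mulrC.
Qed.

Lemma is_derive_tr {R : realType} {V : normedModType R} {a b : nat}
    (M : V -> 'M[R]_(a, b)) x v dM :
  is_derive x v M dM -> is_derive x v (fun y => (M y)^T) dM^T.
Proof.
move=> hM; apply: is_derive_mx => i j.
have -> : (fun y => (M y)^T i j) = (fun y => M y j i : R).
  by apply/funext => y; rewrite mxE.
by rewrite mxE; exact: is_derive_mx_entry.
Qed.

Lemma is_derive_dot {R : realType} {V : normedModType R} {a : nat}
    (f g : V -> 'rV[R]_a) x v df dg :
  is_derive x v f df -> is_derive x v g dg ->
  is_derive x v (fun y => dot (f y) (g y)) (dot df (g x) + dot (f x) dg).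
Proof.
move=> hf hg; have := is_derive_mulmx hf (is_derive_tr hg).
by move=> /(is_derive_mx_entry ord0 ord0) /is_derive_eq; apply; rewrite mxE.
Qed.

Section CkMatrix.
Context {R : realType} {m : nat}.
Implicit Types (U : set 'rV[R]_m) (k : nat).

Lemma CkZl {V : normedModType R} k U (f : 'rV[R]_m -> R) (a : V) : open U ->
  Ck k U f -> Ck k U (fun x => f x *: a).
Proof.
move=> oU; elim: k f => [|k IH] f.
  move=> cf x Ux.
  exact: (continuous_comp (cf x Ux) (@scalel_continuous _ _ a (f x))).
move=> [df Df]; split=> [x Ux|v]; first exact/differentiableZl/df.
apply: (Ck_eq (f := fun x => 'D_v f x *: a)) (IH _ (Df v)) => // x Ux.
have dfx := df x Ux; have dfa := differentiableZl a dfx.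
by rewrite (deriveE _ dfx) (deriveE _ dfa) diffZl.
Qed.

Lemma Ck_mxP {a b : nat} k U (M : 'rV[R]_m -> 'M[R]_(a, b)) : open U ->
  Ck k U M <-> forall i j, Ck k U (fun x => M x i j : R).
Proof.
move=> oU; split=> [|hM]; last first.
  rewrite (mx_delta_sum M); apply: Ck_sum => // i _; apply: Ck_sum => // j _.
  exact: CkZl.
elim: k M => [|k IH] M.
  move=> cM i j x Ux.
  exact: (continuous_comp (cM x Ux) (@coord_continuous _ _ _ i j (M x))).
move=> [dM DM] i j; split=> [x Ux|v]; first exact: ((differentiable_mxP M x).1 (dM x Ux)).
apply: (Ck_eq (V := R) (f := fun x => ('D_v M x) i j)) => // [x Ux|].
  by rewrite derive_mxE //; exact/diff_derivable/dM.
exact: (IH _ (DM v) i j).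
Qed.

Lemma Ck_scale {a b : nat} k U (f : 'rV[R]_m -> R) (M : 'rV[R]_m -> 'M[R]_(a, b)) : open U ->
  Ck k U f -> Ck k U M -> Ck k U (fun x => f x *: M x).
Proof.
move=> oU hf /Ck_mxP hM; apply/Ck_mxP => // i j.
apply: (Ck_eq (V := R) (f := fun x => f x * M x i j)) => //.
  by move=> x _; rewrite mxE.
by apply: CkM => //; exact: hM.
Qed.

Lemma Ck_mulmx {a b c : nat} k U (M : 'rV[R]_m -> 'M[R]_(a, b))
    (P : 'rV[R]_m -> 'M[R]_(b, c)) : open U ->
  Ck k U M -> Ck k U P -> Ck k U (fun x => M x *m P x).
Proof.
move=> oU /Ck_mxP hM /Ck_mxP hP; apply/Ck_mxP => // i j.
apply: (Ck_eq (V := R) (f := fun x => \sum_l M x i l * P x l j)) => //.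
  by move=> x _; rewrite mxE.
by apply: Ck_sum => // l _; apply: CkM => //; [exact: hM|exact: hP].
Qed.

Lemma Ck_det {a : nat} k U (M : 'rV[R]_m -> 'M[R]_a) : open U ->
  Ck k U M -> Ck k U (fun x => \det (M x)).
Proof.
move=> oU /Ck_mxP hM; apply: Ck_sum => // s _.
apply: CkM => //; first exact: Ck_cst.
by apply: Ck_prod => // i _; exact: hM.
Qed.

(** By Cramer's rule the entries of the inverse are rational in those of the matrix. *)
Lemma Ck_invmx {a : nat} k U (M : 'rV[R]_m -> 'M[R]_a) : open U ->
  (forall x, U x -> M x \in unitmx) ->
  Ck k U M -> Ck k U (fun x => invmx (M x)).
Proof.
move=> oU uM hM.
apply: (Ck_eq (f := fun x => (\det (M x))^-1 *: \adj (M x))) => //.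
  by move=> x Ux; rewrite /invmx uM.
apply: Ck_scale => //.
  apply: CkV => //; last exact: Ck_det.
  by move=> x /uM; rewrite unitmxE unitfE.
apply/Ck_mxP => // i j.
apply: (Ck_eq (V := R)
  (f := fun x => (-1) ^+ (j + i) * \det (row' j (col' i (M x))))) => //.
  by move=> x _; rewrite mxE.
apply: CkM => //; first exact: Ck_cst.
apply: Ck_det => //; apply/Ck_mxP => // r s.
apply: (Ck_eq (V := R) (f := fun x => M x (lift j r) (lift i s))) => //.
  by move=> x _; rewrite !mxE.
by move/Ck_mxP : hM; apply.
Qed.

Lemma Ck_derive_alongR k U (f : 'rV[R]_m -> R) y : open U ->
  Ck k.+1 U f -> Ck k U y -> Ck k U (fun x => 'D_(y x) f x).
Proof.
move=> oU [df Df] /Ck_mxP hy.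
apply: (Ck_eq (V := R)
  (f := fun x => \sum_a y x 0 a * 'D_(delta_mx 0 a) f x)) => //.
  by move=> x /df dfx; rewrite [RHS]derive_delta.
by apply: Ck_sum => // a _; apply: CkM => //; [exact: hy|exact: Df].
Qed.

Lemma Ck_derive_along {a b : nat} k U (f : 'rV[R]_m -> 'M[R]_(a, b)) y :
  open U -> Ck k.+1 U f -> Ck k U y -> Ck k U (fun x => 'D_(y x) f x).
Proof.
move=> oU hf hy; have df : forall x, U x -> differentiable f x by case: hf.
apply/Ck_mxP => // i j.
apply: (Ck_eq (V := R) (f := fun x => 'D_(y x) (fun z => f z i j : R) x)) => //.
  by move=> x Ux; rewrite derive_mxE //; exact/diff_derivable/df.
by apply: Ck_derive_alongR => //; move/(Ck_mxP _ _ oU): hf; apply.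
Qed.

End CkMatrix.

Section CkComp.
Context {R : realType} {m l : nat}.
Implicit Types (U : set 'rV[R]_m) (O : set 'rV[R]_l).

(** The chain rule expresses the derivative of the composite as a sum of products of
    [D_v h] with derivatives of [f] composed with [h], to which the induction applies. *)
Lemma Ck_compR k U O (h : 'rV[R]_m -> 'rV[R]_l) (f : 'rV[R]_l -> R) :
  open U -> open O -> (forall x, U x -> O (h x)) ->
  Ck k U h -> Ck k O f -> Ck k U (f \o h).
Proof.
move=> oU oU' hU; elim: k f => [|k IH] f.
  by move=> ch cf x Ux; exact: (continuous_comp (ch x Ux) (cf _ (hU _ Ux))).
move=> hh hf; have [dh Dh] := hh; have [df Df] := hf.
split=> [x Ux|v].
  by apply: differentiable_comp; [exact: dh|exact/df/hU].
apply: (Ck_eq (V := R)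
  (f := fun x => \sum_a ('D_v h x) 0 a * ('D_(delta_mx 0 a) f \o h) x)) => //.
  move=> x Ux; have dfx := df _ (hU x Ux).
  by rewrite (derive_chain _ (dh x Ux) dfx) [RHS]derive_delta.
apply: Ck_sum => // a _; apply: CkM => //.
  by have /(Ck_mxP _ _ oU) := Dh v; apply.
by apply: (IH _ (CkW hh)); exact: Df.
Qed.

Lemma Ck_comp {a b : nat} k U O (h : 'rV[R]_m -> 'rV[R]_l)
    (f : 'rV[R]_l -> 'M[R]_(a, b)) :
  open U -> open O -> (forall x, U x -> O (h x)) ->
  Ck k U h -> Ck k O f -> Ck k U (f \o h).
Proof.
move=> oU oU' hU hh /Ck_mxP hf; apply/Ck_mxP => // i j.
by apply: (Ck_compR (f := fun y => f y i j) oU oU' hU hh); exact: hf.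
Qed.

End CkComp.

(** * Symmetry of second derivatives *)

Section Schwarz.
Context {R : realType} {m : nat}.
Implicit Types (f : 'rV[R]_m -> R) (x y v w : 'rV[R]_m).

Lemma is_derive_line x v (s : R) : is_derive s 1 (fun t : R => x + t *: v) v.
Proof.
have dl : differentiable ( *:%R^~ v : R -> 'rV[R]_m) s by [].
have h1 : is_derive s 1 (cst x : R -> 'rV[R]_m) 0 by exact: is_derive_cst.
have h2 : is_derive s 1 ( *:%R^~ v : R -> 'rV[R]_m) v.
  apply: DeriveDef; first exact: diff_derivable.
  by rewrite deriveE // diff_val scale1r.
by have := is_deriveD h1 h2; rewrite add0r.
Qed.

Lemma MVT_line f x v (h : R) : 0 < h ->
  (forall s, 0 <= s <= h -> differentiable f (x + s *: v)) ->
  exists2 s, 0 <= s <= h & f (x + h *: v) - f x = h * 'D_v f (x + s *: v).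
Proof.
move=> h0 df; pose u (t : R) := x + t *: v.
have du (s : R) : 0 <= s <= h -> is_derive s 1 (f \o u) ('D_v f (x + s *: v)).
  move=> sh; have us := is_derive_line x v s.
  have dus : differentiable u s by apply/derivable1_diffP; case: us.
  have dfu : differentiable f (u s) by exact: df.
  apply: DeriveDef; first exact/diff_derivable/differentiable_comp.
  by rewrite (derive_chain _ dus dfu); case: us => _ ->.
have [s sh e] : exists2 s, s \in `[0, h]%R &
    (f \o u) h - (f \o u) 0 = 'D_v f (x + s *: v) * (h - 0).
  apply: (MVT_segment (ltW h0)) => [s|].
    by rewrite in_itv /= => /andP[s0 sh]; apply: du; rewrite !ltW.
  apply: derivable_within_continuous => s; rewrite in_itv /= => sh.
  by have [] := du s sh.
exists s; first by move: sh; rewrite in_itv.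
by move: e; rewrite /u /= scale0r addr0 subr0 mulrC.
Qed.

(** The second difference of [f], symmetric in [v] and [w]. *)
Let diff2 f x v w (h : R) :=
  f (x + h *: v + h *: w) - f (x + h *: v) - (f (x + h *: w) - f x).

(** The mean value theorem along [v], for the increment of [f] along [w], and then
    along [w], for [D_v f]. *)
Lemma diff2_mean f x v w (h : R) : 0 < h ->
  (forall s t, 0 <= s <= h -> 0 <= t <= h ->
    differentiable f (x + s *: v + t *: w) /\
    differentiable ('D_v f) (x + s *: v + t *: w)) ->
  exists s t, [/\ 0 <= s <= h, 0 <= t <= h &
    diff2 f x v w h = h * (h * 'D_w ('D_v f) (x + s *: v + t *: w))].
Proof.
move=> h0 df; have hh : 0 <= h <= h by apply/andP; split=> //; exact: ltW.
have h00 : (0 : R) <= (0 : R) <= h by rewrite (ltW h0) lexx.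
pose F y := f (y + h *: w) - f y.
have dF s : 0 <= s <= h -> differentiable F (x + s *: v) /\
    'D_v F (x + s *: v) = 'D_v f (x + s *: v + h *: w) - 'D_v f (x + s *: v).
  move=> sh; have [d1 _] := df s h sh hh; have [d0 _] := df s 0 sh h00.
  rewrite scale0r addr0 in d0.
  have ds : differentiable (fun y => y + h *: w) (x + s *: v).
    have did : differentiable (@idfun 'rV[R]_m) (x + s *: v) by [].
    exact: (differentiableD did (differentiable_cst (h *: w) _)).
  have d1' : differentiable (f \o (fun y => y + h *: w)) (x + s *: v).
    exact: (differentiable_comp ds d1).
  have -> : F = (f \o (fun y => y + h *: w)) - f by [].
  split; first exact: differentiableB.
  rewrite deriveB; [|exact: diff_derivable|exact: diff_derivable].
  congr (_ - _); rewrite (derive_chain v ds d1); congr ('D_ _ f _).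
  have -> : (fun y => y + h *: w) = id + cst (h *: w) by [].
  have [_ ->] : is_derive (x + s *: v) v (id + cst (h *: w)) (v + 0).
    by apply: is_deriveD.
  by rewrite addr0.
have [s sh es] : exists2 s, 0 <= s <= h &
    F (x + h *: v) - F x = h * 'D_v F (x + s *: v).
  by apply: (MVT_line (f := F) h0) => s sh; case: (dF s sh).
have [t th et] : exists2 t, 0 <= t <= h &
    'D_v f (x + s *: v + h *: w) - 'D_v f (x + s *: v) =
    h * 'D_w ('D_v f) (x + s *: v + t *: w).
  by apply: (MVT_line (f := 'D_v f) h0) => t th; case: (df s t sh th).
exists s, t; split; [exact: sh|exact: th|].
have [_ e] := dF s sh.
exact: etrans es (congr1 ( *%R h) (etrans e et)).
Qed.

Lemma eq_of_near_values (g h : 'rV[R]_m -> R) x :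
  {for x, continuous g} -> {for x, continuous h} ->
  (forall d, 0 < d -> exists y z, [/\ `|x - y| < d, `|x - z| < d & g y = h z]) ->
  g x = h x.
Proof.
move=> cg ch gh; apply/eqP; rewrite -subr_eq0 -normr_le0.
apply/ler_addgt0Pl => e e0; rewrite addr0.
have e2 : 0 < e / 2 by rewrite divr_gt0.
have /nbhs_normP[d1 /= d10 gP] : \forall y \near x, `|g x - g y| < e / 2.
  exact: ((cvgrPdist_lt _ _).1 cg _ e2).
have /nbhs_normP[d2 /= d20 hP] : \forall y \near x, `|h x - h y| < e / 2.
  exact: ((cvgrPdist_lt _ _).1 ch _ e2).
have [|y [z [xy xz gyhz]]] := gh (Num.min d1 d2); first by rewrite lt_min d10.
move: xy xz; rewrite !lt_min => /andP[/gP gy _] /andP[_ /hP hz].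
rewrite -(subrK (g y) (g x)) {2}gyhz -addrA (le_trans (ler_normD _ _)) //.
by rewrite [e]splitr lerD ?ltW // distrC.
Qed.

(** The symmetric second difference is a value of either mixed derivative at points
    as close to [x] as wanted, and both mixed derivatives are continuous. *)
Lemma derive_comm (U : set 'rV[R]_m) f x v w :
  open U -> U x -> Ck 2 U f -> 'D_w ('D_v f) x = 'D_v ('D_w f) x.
Proof.
move=> oU Ux [df Df].
have cvw : {for x, continuous ('D_w ('D_v f))}.
  by have [_ c] := Df v; exact: c.
have cwv : {for x, continuous ('D_v ('D_w f))}.
  by have [_ c] := Df w; exact: c.
apply: (eq_of_near_values cvw cwv) => d d0 {cvw cwv}.
have /nbhs_normP[r /= r0 rU] : \forall y \near x, U y by exact: open_nbhs_nbhs.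
pose D := Num.min d r; have D0 : 0 < D by rewrite lt_min d0.
(* For this [h] the parallelogram on [h v] and [h w] stays in [U] and at distance
   less than [d] from [x]. *)
pose c := `|v| + `|w| + 1.
have c0 : 0 < c by rewrite ltr_wpDl ?addr_ge0.
pose h := D / 2 / c.
have h0 : 0 < h by rewrite !divr_gt0.
have near_x s t : 0 <= s <= h -> 0 <= t <= h -> `|x - (x + s *: v + t *: w)| < D.
  move=> /andP[s0 sh] /andP[t0 th].
  rewrite -addrA opprD addNKr normrN.
  apply: (le_lt_trans (ler_normD _ _)); rewrite !normrZ !ger0_norm //.
  have hc : h * c = D / 2 by rewrite /h divfK // gt_eqF.
  have : s * `|v| + t * `|w| <= h * c.
    rewrite /c !mulrDr mulr1 -[leLHS]addr0 lerD ?(ltW h0) //.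
    by rewrite lerD // ler_wpM2r.
  rewrite hc => /le_lt_trans; apply.
  by rewrite ltr_pdivrMr // mulr_natr mulr2n ltrDl.
have near_U s t (sh : 0 <= s <= h) (th : 0 <= t <= h) : U (x + s *: v + t *: w).
  by apply: rU; have := near_x s t sh th; rewrite lt_min => /andP[].
have [s [t [sh th E1]]] : exists s t, [/\ 0 <= s <= h, 0 <= t <= h &
    diff2 f x v w h = h * (h * 'D_w ('D_v f) (x + s *: v + t *: w))].
  apply: diff2_mean => // s t sh th.
  split; first exact/df/near_U.
  by have [dv _] := Df v; exact/dv/near_U.
have [t' [s' [th' sh' E2]]] : exists s t, [/\ 0 <= s <= h, 0 <= t <= h &
    diff2 f x w v h = h * (h * 'D_v ('D_w f) (x + s *: w + t *: v))].
  apply: diff2_mean => // t1 s1 th1 sh1; rewrite addrAC.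
  split; first exact/df/near_U.
  by have [dw _] := Df w; exact/dw/near_U.
rewrite addrAC in E2.
exists (x + s *: v + t *: w), (x + s' *: v + t' *: w); split.
- by have := near_x s t sh th; rewrite lt_min => /andP[].
- by have := near_x s' t' sh' th'; rewrite lt_min => /andP[].
have EE : diff2 f x v w h = diff2 f x w v h.
  have swap (a b c0' d' : R) : a - b - (c0' - d') = a - c0' - (b - d') by ring.
  by rewrite /diff2 [x + _ + _]addrAC swap.
have hn0 : h != 0 by rewrite gt_eqF.
by move: EE; rewrite E1 E2 => /(mulfI hn0)/(mulfI hn0).
Qed.

End Schwarz.

Lemma derive_comm_mx {R : realType} {m a b : nat} (U : set 'rV[R]_m)
    (f : 'rV[R]_m -> 'M[R]_(a, b)) x v w :
  open U -> U x -> Ck 2 U f -> 'D_w ('D_v f) x = 'D_v ('D_w f) x.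
Proof.
move=> oU Ux hf; have [df Df] := hf; apply/matrixP => i j.
have [dv _] := Df v; have [dw _] := Df w.
have entry u u' : differentiable ('D_u f) x ->
    ('D_u' ('D_u f) x) i j = 'D_u' ('D_u (fun z => f z i j : R)) x.
  move=> du; have du' : derivable ('D_u f) x u' by exact: diff_derivable.
  rewrite (derive_mxE i j du'); apply: near_eq_derive.
  apply: (open_near oU Ux) => y Uy.
  have dfy : derivable f y u by exact/diff_derivable/df.
  exact: derive_mxE dfy.
have fij : Ck 2 U (fun z => f z i j : R) by exact: ((Ck_mxP _ _ oU).1 hf i j).
have e := derive_comm v w oU Ux fij.
exact: (etrans (entry v w (dv x Ux)) (etrans e (esym (entry w v (dw x Ux))))).
Qed.

(** * Charts, tangent vectors and Lie brackets *)

Lemma Ck_local {R : realType} {m : nat} {V : normedModType R} k (U : set 'rV[R]_m)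
    (f : 'rV[R]_m -> V) :
  (forall x, U x -> exists O, O x /\ Ck k O f) -> Ck k U f.
Proof.
elim: k f => [|k IH] f hf /=.
  by move=> x /hf[A [Ax cf]]; exact: cf.
split=> [x /hf[A [Ax [df _]]]|v]; first exact: df.
apply: IH => x /hf[A [Ax [_ Df]]]; exists A; split; [exact: Ax|exact: Df].
Qed.

Lemma derive_subl {R : realType} {V W : normedModType R} (f : V -> W) x u v :
  differentiable f x -> 'D_(u - v) f x = 'D_u f x - 'D_v f x.
Proof. by move=> df; rewrite !deriveE // linearB. Qed.

(** By symmetry of the second derivatives, the second summand is the derivative of
    [D_u f] in the direction that [y] takes at [x]; in a commutator of two such
    derivatives it cancels. *)
Lemma is_derive_along {R : realType} {m a b : nat} (U : set 'rV[R]_m)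
    (f : 'rV[R]_m -> 'M[R]_(a, b)) (y : 'rV[R]_m -> 'rV[R]_m) x u dy :
  open U -> U x -> Ck 2 U f -> is_derive x u y dy ->
  is_derive x u (fun z => 'D_(y z) f z) ('D_dy f x + 'D_(y x) ('D_u f) x).
Proof.
move=> oU Ux hf hy; have [df Df] := hf.
have d2 v : differentiable ('D_v f) x by have [dv _] := Df v; exact: dv.
have e : \forall z \near x,
    (\sum_c (fun z => y z 0 c *: 'D_(delta_mx 0 c) f z)) z = 'D_(y z) f z.
  apply: (open_near oU Ux) => z Uz; rewrite fct_sumE [RHS]derive_delta //.
  exact: df.
apply: (near_eq_is_derive e); apply: is_derive_eq.
  apply: is_derive_sum => c; apply: is_derive_scale; last exact: is_derive_diff.
  exact: is_derive_mx_entry.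
rewrite big_split /=; apply: (congr2 +%R).
  exact: (esym (derive_delta dy (df x Ux))).
apply: (etrans _ (esym (derive_delta (y x) (d2 u)))); apply: eq_bigr => c _.
by apply: congr1; exact: (derive_comm_mx _ _ oU Ux hf).
Qed.

Section Charts.
Context {R : realType} {m : nat} {M : manifold R m}.
Implicit Types (c d : chart M) (p q : M) (U : set M).

Lemma chart_paramP c x : (chart_coord c @` chart_dom c) x ->
  chart_dom c (chart_param c x) /\ chart_coord c (chart_param c x) = x.
Proof. by move=> [p cp <-]; rewrite chart_coordK. Qed.

Lemma near_param c p (P : M -> Prop) : chart_dom c p ->
  (\forall q \near p, P q) ->
  \forall x \near chart_coord c p, P (chart_param c x).
Proof.
move=> cp nP.
have cpi : (chart_coord c @` chart_dom c) (chart_coord c p) by exists p.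
have := chart_param_continuous cpi; apply.
by rewrite /= chart_coordK.
Qed.

Lemma near_chart_image c p : chart_dom c p ->
  \forall x \near chart_coord c p, (chart_coord c @` chart_dom c) x.
Proof.
by move=> cp; apply: open_nbhs_nbhs; split; [exact: chart_codom_open|exists p].
Qed.

Lemma near_chart_dom c p : chart_dom c p -> \forall q \near p, chart_dom c q.
Proof.
by move=> cp; apply: open_nbhs_nbhs; split=> //; exact: chart_dom_open.
Qed.

Lemma chart_image_open c U : open U ->
  open (chart_coord c @` (chart_dom c `&` U)).
Proof.
move=> oU; rewrite openE => _ [p [cp Up] <-].
have nU : \forall q \near p, U q by exact: open_nbhs_nbhs.
have := near_param cp nU; have := near_chart_image cp.
apply: filterS2 => x /chart_paramP[cx xK] Ux.
by exists (chart_param c x).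
Qed.

Lemma chart_imageP c U x : (chart_coord c @` (chart_dom c `&` U)) x ->
  [/\ chart_dom c (chart_param c x), U (chart_param c x) &
      chart_coord c (chart_param c x) = x].
Proof. by move=> [p [cp Up] <-]; rewrite chart_coordK. Qed.

Lemma transition_differentiable c d p : chart_dom c p -> chart_dom d p ->
  differentiable (chart_coord d \o chart_param c) (chart_coord c p).
Proof.
by move=> cp dp; have [df _] := transition_smooth c d 1%N; apply: df; exists p.
Qed.

Lemma near_transition {V : normedModType R} (f : M -> V) c d p :
  chart_dom c p -> chart_dom d p ->
  \forall x \near chart_coord d p,
    ((f \o chart_param c) \o (chart_coord c \o chart_param d)) x =
    (f \o chart_param d) x.
Proof.
move=> cp dp; have := near_param dp (near_chart_dom cp).
by apply: filterS => x cx /=; rewrite chart_coordK.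
Qed.

Lemma differentiable_chart {V : normedModType R} (f : M -> V) c d p :
  chart_dom c p -> chart_dom d p ->
  differentiable (f \o chart_param c) (chart_coord c p) ->
  differentiable (f \o chart_param d) (chart_coord d p).
Proof.
move=> cp dp df; apply: near_eq_differentiable (near_transition f cp dp) _.
apply: differentiable_comp; first exact: transition_differentiable.
by rewrite /= chart_coordK.
Qed.

(** Tangent vectors at a point are named by the preferred chart of that point, which
    varies with the point; this lemma allows to work in a single chart near a point. *)
Lemma derive_chart {V : normedModType R} (f : M -> V) c d p v :
  chart_dom c p -> chart_dom d p ->
  differentiable (f \o chart_param c) (chart_coord c p) ->
  'D_v (f \o chart_param d) (chart_coord d p) =
  'D_('D_v (chart_coord c \o chart_param d) (chart_coord d p))
     (f \o chart_param c) (chart_coord c p).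
Proof.
move=> cp dp df; rewrite -(near_eq_derive _ (near_transition f cp dp)).
rewrite derive_chain; last by rewrite /= chart_coordK.
  by rewrite /= chart_coordK.
exact: transition_differentiable.
Qed.

Definition differentiable_at {V : normedModType R} (f : M -> V) p : Prop :=
  differentiable (f \o chart_param (chart_at p)) (chart_coord (chart_at p) p).

Lemma differentiable_atP {V : normedModType R} (f : M -> V) c p :
  chart_dom c p ->
  differentiable (f \o chart_param c) (chart_coord c p) <-> differentiable_at f p.
Proof.
by move=> cp; split; apply: differentiable_chart => //; exact: chart_at_dom.
Qed.

Lemma der_chart {V : normedModType R} (f : M -> V) c p v :
  chart_dom c p -> differentiable_at f p ->
  der f p v = 'D_(components c p v) (f \o chart_param c) (chart_coord c p).
Proof.
move=> cp df; apply: derive_chart => //; first exact: chart_at_dom.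
exact/differentiable_atP.
Qed.

Lemma der_linear {V : normedModType R} (f : M -> V) p :
  differentiable_at f p -> linear (der f p).
Proof. by move=> df; exact: derive_linear. Qed.

Lemma is_derive_der {V : normedModType R} (f : M -> V) p v :
  differentiable_at f p ->
  is_derive (chart_coord (chart_at p) p) v (f \o chart_param (chart_at p)) (der f p v).
Proof. exact: is_derive_diff. Qed.

Lemma near_eq_der {V : normedModType R} (f g : M -> V) p v :
  (\forall q \near p, f q = g q) -> der f p v = der g p v.
Proof.
move=> fg; apply: near_eq_derive.
exact: (near_param (chart_at_dom p) fg).
Qed.

Lemma near_eq_differentiable_at {V : normedModType R} (f g : M -> V) p :
  (\forall q \near p, f q = g q) -> differentiable_at f p -> differentiable_at g p.
Proof.
move=> fg; apply: near_eq_differentiable.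
exact: (near_param (chart_at_dom p) fg).
Qed.

Lemma smooth_fun_differentiable_at {V : normedModType R} U (f : M -> V) p :
  smooth_fun U f -> U p -> differentiable_at f p.
Proof.
move=> sf Up; have [df _] := sf (chart_at p) 1%N; apply: df; exists p => //.
by split=> //; exact: chart_at_dom.
Qed.

Lemma chart_coord_smooth c : smooth_fun (chart_dom c) (chart_coord c).
Proof. by move=> d; exact: transition_smooth. Qed.

Lemma chart_coord_differentiable_at c p :
  chart_dom c p -> differentiable_at (chart_coord c) p.
Proof.
by move=> cp; apply: smooth_fun_differentiable_at cp; exact: chart_coord_smooth.
Qed.

Lemma components_linear c p : chart_dom c p -> linear (components c p).
Proof. by move=> cp; apply: der_linear; exact: chart_coord_differentiable_at. Qed.

Lemma derive_chart_id c p u : chart_dom c p ->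
  'D_u (chart_coord c \o chart_param c) (chart_coord c p) = u.
Proof.
move=> cp; rewrite (near_eq_derive (g := id)) ?derive_id //.
have := near_chart_image cp; apply: filterS => x /chart_paramP[_ xK].
exact: xK.
Qed.

Lemma components_chart_at p v : components (chart_at p) p v = v.
Proof. by apply: derive_chart_id; exact: chart_at_dom. Qed.

(** The inverse of [components c p]. *)
Definition vector_of c p (u : 'rV[R]_m) : 'rV[R]_m :=
  'D_u (chart_coord (chart_at p) \o chart_param c) (chart_coord c p).

Lemma components_vector_of c d p u : chart_dom c p -> chart_dom d p ->
  components d p (vector_of c p u) =
  'D_u (chart_coord d \o chart_param c) (chart_coord c p).
Proof.
move=> cp dp; have ap := chart_at_dom p; rewrite /components /der.
by rewrite -derive_chart //; apply: transition_differentiable.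
Qed.

Lemma vector_ofK c p u : chart_dom c p -> components c p (vector_of c p u) = u.
Proof. by move=> cp; rewrite components_vector_of // derive_chart_id. Qed.

Lemma componentsK c p v : chart_dom c p -> vector_of c p (components c p v) = v.
Proof.
move=> cp; have ap := chart_at_dom p; rewrite /vector_of /components /der.
rewrite -derive_chart //; first exact: derive_chart_id.
exact: transition_differentiable.
Qed.

Lemma vector_of_chart_at p u : vector_of (chart_at p) p u = u.
Proof. exact/derive_chart_id/chart_at_dom. Qed.

End Charts.
Arguments chart_image_open {R m M} c [U].

Section Maps.
Context {R : realType} {m k : nat} {M : manifold R m} {P : manifold R k}.
Variables (F : M -> P) (sF : smooth_map F).

Lemma near_map p (O : P -> Prop) :
  (\forall y \near F p, O y) -> \forall q \near p, O (F q).
Proof. by move=> nO; have [cF _] := sF; exact: cF. Qed.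

Lemma smooth_map_coord_differentiable d p : chart_dom d (F p) ->
  differentiable_at (chart_coord d \o F) p.
Proof.
move=> dp; have [_ /(_ (chart_at p) d 1%N)[df _]] := sF.
by apply: df; exists p => //; split=> //; exact: chart_at_dom.
Qed.

Lemma near_chart_map {V : normedModType R} (f : P -> V) d p :
  chart_dom d (F p) ->
  \forall q \near p, ((f \o chart_param d) \o (chart_coord d \o F)) q = (f \o F) q.
Proof.
move=> dp; have := near_map (near_chart_dom dp).
by apply: filterS => q dq /=; rewrite chart_coordK.
Qed.

Lemma differentiable_at_comp {V : normedModType R} (f : P -> V) p :
  differentiable_at f (F p) -> differentiable_at (f \o F) p.
Proof.
move=> df; have dp := chart_at_dom (F p).
apply: near_eq_differentiable_at (near_chart_map f dp) _.
have dF := smooth_map_coord_differentiable dp.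
apply: (differentiable_comp dF); rewrite /= chart_coordK //.
exact: chart_at_dom.
Qed.

Lemma der_comp {V : normedModType R} (f : P -> V) p v :
  differentiable_at f (F p) ->
  der f (F p) (tangent_map F p v) = der (f \o F) p v.
Proof.
move=> df; have dp := chart_at_dom (F p).
rewrite -(near_eq_der _ (near_chart_map f dp)) /der.
have dF := smooth_map_coord_differentiable dp.
have pK : (chart_coord (chart_at (F p)) \o F \o chart_param (chart_at p))
    (chart_coord (chart_at p) p) = chart_coord (chart_at (F p)) (F p).
  by rewrite /= chart_coordK //; exact: chart_at_dom.
rewrite -[RHS]/('D_v ((f \o chart_param (chart_at (F p))) \o
  (chart_coord (chart_at (F p)) \o F \o chart_param (chart_at p))) _).
by rewrite derive_chain ?pK.
Qed.

Lemma tangent_map_linear p : linear (tangent_map F p).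
Proof.
by apply: der_linear; apply: smooth_map_coord_differentiable; exact: chart_at_dom.
Qed.

Lemma components_tangent_map c d p v : chart_dom c p -> chart_dom d (F p) ->
  components d (F p) (tangent_map F p v) =
  'D_(components c p v) (chart_coord d \o F \o chart_param c) (chart_coord c p).
Proof.
move=> cp dp; rewrite /(components d) der_comp; last exact: chart_coord_differentiable_at.
rewrite (der_chart _ cp) //; exact: smooth_map_coord_differentiable.
Qed.

Lemma open_preimage (O : set P) : open O -> open (F @^-1` O).
Proof. by move=> oO; have [cF _] := sF; apply: open_comp => // x _; exact: cF. Qed.

(** Smoothness being local, one chart of the target around the image of each point
    is enough. *)
Lemma smooth_fun_comp {a b : nat} (O : set P) (f : P -> 'M[R]_(a, b)) :
  open O -> smooth_fun O f -> smooth_fun (F @^-1` O) (f \o F).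
Proof.
move=> oO sf c j; apply: Ck_local => _ [p [cp Op] <-].
pose d := chart_at (F p); have dp : chart_dom d (F p) := chart_at_dom (F p).
pose A := chart_dom c `&` F @^-1` (O `&` chart_dom d).
have oA : open (F @^-1` (O `&` chart_dom d)).
  by apply: open_preimage; apply: openI => //; exact: chart_dom_open.
exists (chart_coord c @` A); split; first by exists p.
have oi := chart_image_open c oA.
apply: (Ck_eq (f := (f \o chart_param d) \o (chart_coord d \o F \o chart_param c))) => //.
  by move=> x /chart_imageP[_ [_ dx] _]; rewrite /= chart_coordK.
apply: (Ck_comp oi (chart_image_open d oO)); last exact: sf.
  move=> x /chart_imageP[_ [Ox dx] _] /=.
  by exists (F (chart_param c x)).
have [_ /(_ c d j)] := sF; apply: Ck_sub => x [q [cq [_ dq]] <-].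
by exists q.
Qed.

End Maps.

Section Fields.
Context {R : realType} {m : nat} {M : manifold R m}.
Implicit Types (U : set M) (X Y : M -> 'rV[R]_m).

Lemma id_smooth_map : smooth_map (@idfun M).
Proof.
split=> [x|c d]; first exact: cvg_id.
exact: transition_smooth.
Qed.

Lemma vector_field_components c U X : open U -> vector_field U X ->
  smooth_on (chart_coord c @` (chart_dom c `&` U))
    (fun x => components c (chart_param c x) (X (chart_param c x))).
Proof.
move=> oU sX k; apply: Ck_sub (sX c c k) => x [q [cq Uq] <-].
by exists q.
Qed.

Lemma field_components_differentiable c X p : chart_dom c p -> field_near p X ->
  differentiable_at (fun q => components c q (X q)) p.
Proof.
move=> cp [U [oU Up] sX]; apply/(differentiable_atP _ cp).
have [df _] := vector_field_components c oU sX 1%N.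
by apply: df; exists p.
Qed.

Lemma der_field_smooth {a b : nat} U (f : M -> 'M[R]_(a, b)) X :
  open U -> smooth_fun U f -> vector_field U X ->
  smooth_fun U (fun q => der f q (X q)).
Proof.
move=> oU sf sX c k; have oi := chart_image_open c oU.
apply: (Ck_eq (f := fun x =>
   'D_(components c (chart_param c x) (X (chart_param c x))) (f \o chart_param c) x)) => //.
  move=> x /chart_imageP[cx Ux xK] /=; rewrite [RHS](der_chart _ cx) ?xK //.
  exact: smooth_fun_differentiable_at Ux.
apply: Ck_derive_along => //; first exact: sf.
exact: vector_field_components.
Qed.

(** The second derivatives of [f] cancel by symmetry; what remains are the
    derivatives of the components of the fields, that is, the bracket. *)
Lemma der_lie {a b : nat} U (f : M -> 'M[R]_(a, b)) X Y p :
  open U -> U p -> smooth_fun U f -> vector_field U X -> vector_field U Y ->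
  der (fun q => der f q (Y q)) p (X p) - der (fun q => der f q (X q)) p (Y p) =
  der f p (lie X Y p).
Proof.
move=> oU Up sf sX sY; pose c := chart_at p.
have cp : chart_dom c p := chart_at_dom p.
pose F := f \o chart_param c; pose x0 := chart_coord c p.
have oi := chart_image_open c oU.
have x0i : (chart_coord c @` (chart_dom c `&` U)) x0 by exists p.
have key Z V : vector_field U Z -> vector_field U V ->
    der (fun q => der f q (Z q)) p (V p) =
    'D_(der (fun q => components c q (Z q)) p (V p)) F x0 + 'D_(Z p) ('D_(V p) F) x0.
  move=> sZ sV; pose z x := components c (chart_param c x) (Z (chart_param c x)).
  have e : \forall x \near x0, 'D_(z x) F x = ((fun q => der f q (Z q)) \o chart_param c) x.
    apply: (open_near oi x0i) => x /chart_imageP[cx Ux xK] /=.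
    rewrite [RHS](der_chart _ cx) ?xK //; exact: smooth_fun_differentiable_at Ux.
  rewrite {1}/der -(near_eq_derive _ e).
  have dz : is_derive x0 (V p) z (der (fun q => components c q (Z q)) p (V p)).
    apply: is_derive_der; apply: field_components_differentiable => //.
    exists U; [exact: conj oU Up|exact: sZ].
  have zx : z x0 = Z p by rewrite /z /x0 chart_coordK // components_chart_at.
  have [_ E] := is_derive_along oi x0i (sf c 2%N) dz.
  by rewrite zx in E; exact: E.
have dF : differentiable F x0 by exact: (smooth_fun_differentiable_at sf Up).
have cancel (V : zmodType) (a1 a2 s : V) : a1 + s - (a2 + s) = a1 - a2.
  by rewrite opprD addrACA subrr addr0.
have sym := derive_comm_mx (Y p) (X p) oi x0i (sf c 2%N).
apply: (etrans (congr2 (fun u v => u - v) (key Y X sY sX)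
  (etrans (key X Y sX sY) (congr1 _ sym)))).
rewrite cancel [RHS]/der -/F -/x0 /lie -/c.
exact: (esym (derive_subl _ _ dF)).
Qed.

End Fields.

(** * Sections and connections along a map *)

Section Sections.
Context {R : realType} {m k : nat} {M : manifold R m} {P : manifold R k}.
Variables (F : M -> P) (sF : smooth_map F).
Implicit Types (U : set M) (s t : M -> 'rV[R]_k).

Lemma section_domain_open (c : chart M) (d : chart P) U : open U ->
  open (chart_coord c @` (chart_dom c `&` U `&` F @^-1` chart_dom d)).
Proof.
move=> oU; rewrite -setIA; apply: chart_image_open; apply: openI => //.
by apply: open_preimage => //; exact: chart_dom_open.
Qed.

Arguments section_domain_open c d [U].

Lemma section_domainP (c : chart M) (d : chart P) U x :
  (chart_coord c @` (chart_dom c `&` U `&` F @^-1` chart_dom d)) x ->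
  [/\ chart_dom c (chart_param c x), U (chart_param c x),
      chart_dom d (F (chart_param c x)) & chart_coord c (chart_param c x) = x].
Proof. by rewrite -setIA => /chart_imageP[cx [Ux dx] xK]. Qed.

Lemma smooth_fun_sub {V : normedModType R} U U' (f : M -> V) :
  U' `<=` U -> smooth_fun U f -> smooth_fun U' f.
Proof.
move=> sU sf c j; apply: Ck_sub (sf c j) => x [q [cq Uq] <-].
by exists q => //; split=> //; exact: sU.
Qed.

Lemma smooth_section_sub U U' s :
  U' `<=` U -> smooth_section F U s -> smooth_section F U' s.
Proof.
move=> sU ss c d j; apply: Ck_sub (ss c d j) => x [q [[cq Uq] dq] <-].
by exists q => //; split=> //; split=> //; exact: sU.
Qed.

Lemma smooth_section0 U : open U -> smooth_section F U (fun=> 0).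
Proof.
move=> oU c d j; have oi := section_domain_open c d oU.
apply: (Ck_eq (f := fun=> 0)) => //; last exact: Ck_cst.
move=> x /section_domainP[_ _ dx _].
by rewrite (linear_fun0 (components_linear dx)).
Qed.

Lemma smooth_sectionD U s t : open U -> smooth_section F U s ->
  smooth_section F U t -> smooth_section F U (fun q => s q + t q).
Proof.
move=> oU ss st c d j; have oi := section_domain_open c d oU.
apply: (Ck_eq (f := fun x =>
   components d (F (chart_param c x)) (s (chart_param c x)) +
   components d (F (chart_param c x)) (t (chart_param c x)))) => //.
  move=> x /section_domainP[_ _ dx _].
  have L := components_linear dx.
  by have := L 1 (s (chart_param c x)) (t (chart_param c x)); rewrite !scale1r => ->.
apply: CkD => //; [exact: ss|exact: st].
Qed.

Lemma smooth_sectionZ U (f : M -> R) s : open U -> smooth_fun U f ->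
  smooth_section F U s -> smooth_section F U (fun q => f q *: s q).
Proof.
move=> oU sf ss c d j; have oi := section_domain_open c d oU.
apply: (Ck_eq (f := fun x => f (chart_param c x) *:
   components d (F (chart_param c x)) (s (chart_param c x)))) => //.
  move=> x /section_domainP[_ _ dx _].
  have L := components_linear dx.
  have := L (f (chart_param c x)) (s (chart_param c x)) 0; rewrite !addr0 => ->.
  by rewrite (linear_fun0 L) addr0.
apply: Ck_scale => //; last exact: ss.
apply: Ck_sub (sf c j) => x [q [[cq Uq] _] <-].
by exists q.
Qed.

Lemma section_near0 p : section_near F p (fun=> 0).
Proof.
exists setT; first by split=> //; exact: openT.
exact: (smooth_section0 openT).
Qed.

Lemma section_nearD p s t : section_near F p s -> section_near F p t ->
  section_near F p (fun q => s q + t q).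
Proof.
move=> [U [oU Up] ss] [U' [oU' U'p] st]; exists (U `&` U').
  by split=> //; exact: openI.
apply: smooth_sectionD; first exact: openI.
  by apply: smooth_section_sub ss; exact: subIsetl.
by apply: smooth_section_sub st; exact: subIsetr.
Qed.

Lemma section_nearZ p (f : M -> R) s : fun_near p f -> section_near F p s ->
  section_near F p (fun q => f q *: s q).
Proof.
move=> [U [oU Up] ss] [U' [oU' U'p] st]; exists (U `&` U').
  by split=> //; exact: openI.
apply: smooth_sectionZ; first exact: openI.
  by apply: smooth_fun_sub ss; exact: subIsetl.
by apply: smooth_section_sub st; exact: subIsetr.
Qed.

Lemma section_near_sum p (I : Type) (r : seq I) (s : I -> M -> 'rV[R]_k) :
  (forall i, section_near F p (s i)) ->
  section_near F p (fun q => \sum_(i <- r) s i q).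
Proof.
move=> ss; elim: r => [|i r IH].
  have -> : (fun q => \sum_(i <- [::]) s i q) = fun=> 0.
    by apply/funext => q; rewrite big_nil.
  exact: section_near0.
have -> : (fun q => \sum_(j <- i :: r) s j q) = fun q => s i q + \sum_(j <- r) s j q.
  by apply/funext => q; rewrite big_cons.
exact: (section_nearD (ss i) IH).
Qed.

Lemma smooth_fun_locally_cst U (a : R) (f : M -> R) : open U ->
  (forall q, U q -> f q = a) -> smooth_fun U f.
Proof.
move=> oU fa c j; have oi := chart_image_open c oU.
apply: (Ck_eq (V := R) (f := fun=> a)) => //; last exact: Ck_cst.
by move=> x /chart_imageP[_ Ux _] /=; rewrite fa.
Qed.

Lemma near_open p (A : M -> Prop) : (\forall q \near p, A q) ->
  exists2 U, open_nbhs p U & forall q, U q -> A q.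
Proof.
move=> nA; have : nbhs p [set q | A q] by exact: nA.
by rewrite nbhsE => -[U nU UA]; exists U.
Qed.

Lemma der_locally_cst {V : normedModType R} p v (a : V) (f : M -> V) :
  (\forall q \near p, f q = a) -> der f p v = 0.
Proof.
move=> fa; rewrite (near_eq_der (g := fun=> a)) // /der.
exact: derive_cst.
Qed.

Section Connection.
Variables (D : (M -> 'rV[R]_k) -> M -> 'rV[R]_m -> 'rV[R]_k).
Hypothesis cD : connection_along F D.

Lemma connection0 p v : D (fun=> 0) p v = 0.
Proof.
have [_ DD _ _] := cD; have n0 := section_near0 p.
have := DD _ _ p v n0 n0.
rewrite -[in LHS](addr0 0) => /(congr1 (fun z => z - D (fun=> 0) p v)).
by rewrite addrK => <-; rewrite -[X in D X](_ : (fun=> 0 + 0) = _) ?addr0 ?subrr.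
Qed.

(** Multiplying by the indicator function of the complement of a neighbourhood,
    which is smooth near [p], turns the Leibniz rule into locality. *)
Lemma connection_locally0 p v s : section_near F p s ->
  (\forall q \near p, s q = 0) -> D s p v = 0.
Proof.
move=> ns /near_open[U [oU Up] s0]; have [_ _ DZ _] := cD.
pose f q : R := if q \in U then 0 else 1.
have fU q : U q -> f q = 0 by move=> Uq; rewrite /f mem_set.
have nf : fun_near p f.
  by exists U => //; exact: smooth_fun_locally_cst fU.
have -> : s = fun q => f q *: s q.
  apply/funext => q; rewrite /f; case: ifPn => [/set_mem/s0->|_].
    by rewrite scaler0.
  by rewrite scale1r.
by rewrite DZ // (s0 _ Up) fU // scaler0 scale0r addr0.
Qed.

Lemma connection_local p v s t : section_near F p s -> section_near F p t ->
  (\forall q \near p, s q = t q) -> D s p v = D t p v.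
Proof.
move=> ns nt st; have [_ DD _ _] := cD.
pose r q := s q + (-1) *: t q.
have n1 : fun_near p (fun=> -1 : R).
  by exists setT; [split=> //; exact: openT|exact: (smooth_fun_locally_cst openT)].
have nr : section_near F p r by exact: (section_nearD ns (section_nearZ n1 nt)).
have -> : s = fun q => t q + r q.
  by apply/funext => q; rewrite /r scaleN1r addrC subrK.
rewrite DD // (connection_locally0 _ nr) ?addr0 //.
by apply: filterS st => q; rewrite /r scaleN1r => ->; rewrite subrr.
Qed.

Lemma connection_sum p v (I : Type) (r : seq I) (f : I -> M -> R)
    (s : I -> M -> 'rV[R]_k) :
  (forall i, fun_near p (f i)) -> (forall i, section_near F p (s i)) ->
  D (fun q => \sum_(i <- r) f i q *: s i q) p v =
  \sum_(i <- r) (der (f i) p v *: s i p + f i p *: D (s i) p v).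
Proof.
move=> nf ns; have [_ DD DZ _] := cD; elim: r => [|i r IH].
  have -> : (fun q => \sum_(i <- [::]) f i q *: s i q) = fun=> 0.
    by apply/funext => q; rewrite big_nil.
  by rewrite big_nil connection0.
have -> : (fun q => \sum_(j <- i :: r) f j q *: s j q) =
    fun q => f i q *: s i q + \sum_(j <- r) f j q *: s j q.
  by apply/funext => q; rewrite big_cons.
have ni := section_nearZ (nf i) (ns i).
have nr := section_near_sum r (fun j => section_nearZ (nf j) (ns j)).
by rewrite big_cons (DD _ _ p v ni nr) IH (DZ _ _ p v (nf i) (ns i)).
Qed.

(** A connection is determined near [p] by its values on a local frame. It is applied
    to the coordinate fields of a chart and to orthonormal frames. *)
Lemma connection_expand p v (I : finType) t (f : I -> M -> R)
    (s : I -> M -> 'rV[R]_k) :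
  section_near F p t ->
  (forall i, fun_near p (f i)) -> (forall i, section_near F p (s i)) ->
  (\forall q \near p, t q = \sum_i f i q *: s i q) ->
  D t p v = \sum_i (der (f i) p v *: s i p + f i p *: D (s i) p v).
Proof.
move=> nt nf ns ts; rewrite -(connection_sum v _ nf ns).
have nr := section_near_sum (index_enum I) (fun j => section_nearZ (nf j) (ns j)).
exact: (connection_local v nt nr ts).
Qed.

End Connection.

Lemma tangent_map_section U (X : M -> 'rV[R]_m) : open U -> vector_field U X ->
  smooth_section F U (fun q => tangent_map F q (X q)).
Proof.
move=> oU sX c d j; have oi := section_domain_open c d oU.
apply: (Ck_eq (f := fun x =>
   'D_(components c (chart_param c x) (X (chart_param c x)))
      (chart_coord d \o F \o chart_param c) x)) => //.
  move=> x /section_domainP[cx Ux dx xK].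
  by rewrite [RHS](components_tangent_map sF _ cx dx) xK.
apply: Ck_derive_along => //.
  have [_ /(_ c d j.+1)] := sF; apply: Ck_sub => x [q [[cq Uq] dq] <-].
  by exists q.
apply: Ck_sub (vector_field_components c oU sX j) => x [q [[cq Uq] dq] <-].
by exists q.
Qed.

End Sections.
Arguments section_domain_open {R m k M P F} sF c d [U].

Section CoordinateFields.
Context {R : realType} {k : nat} {P : manifold R k}.
Implicit Types (d : chart P).

(** The coordinate fields of a chart: a local frame with vanishing brackets, see
    [lie_coord_field]. *)
Definition coord_field d (a : 'I_k) (y : P) : 'rV[R]_k :=
  vector_of d y (delta_mx 0 a).

Lemma coord_field_section {m : nat} {M : manifold R m} (F : M -> P) d a :
  smooth_map F -> smooth_section F (F @^-1` chart_dom d) (coord_field d a \o F).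
Proof.
move=> sF c d' j.
have oU : open (F @^-1` chart_dom d).
  by apply: open_preimage => //; exact: chart_dom_open.
have oi := section_domain_open sF c d' oU.
pose tau := chart_coord d' \o chart_param d.
apply: (Ck_eq (f := 'D_(delta_mx 0 a) tau \o (chart_coord d \o F \o chart_param c))) => //.
  move=> x /section_domainP[cx dx d'x xK].
  by rewrite /= [RHS]components_vector_of.
have od : open (chart_coord d @` (chart_dom d `&` chart_dom d')).
  by apply: chart_image_open; exact: chart_dom_open.
apply: (Ck_comp oi od).
- move=> x /section_domainP[cx dx d'x xK].
  by exists (F (chart_param c x)).
- have [_ /(_ c d j)] := sF; apply: Ck_sub => x [q [[cq dq] d'q] <-].
  by exists q.
have [_ dt] := transition_smooth d d' j.+1.
exact: dt.
Qed.

Lemma coord_field_vector_field d a : vector_field (chart_dom d) (coord_field d a).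
Proof. exact: (coord_field_section d a (@id_smooth_map R k P)). Qed.

Lemma coord_field_near d a y : chart_dom d y -> field_near y (coord_field d a).
Proof.
move=> dy; exists (chart_dom d); last exact: coord_field_vector_field.
by split=> //; exact: chart_dom_open.
Qed.

Lemma vector_of_linear d y : chart_dom d y -> linear (vector_of d y).
Proof.
move=> dy; apply: derive_linear; apply: transition_differentiable => //.
exact: chart_at_dom.
Qed.

Lemma vector_of_delta d y u : chart_dom d y ->
  vector_of d y u = \sum_a u 0 a *: coord_field d a y.
Proof.
move=> dy; rewrite /vector_of derive_delta //.
by apply: transition_differentiable => //; exact: chart_at_dom.
Qed.

Lemma lie_coord_field d a b y : chart_dom d y -> d = chart_at y ->
  lie (coord_field d a) (coord_field d b) y = 0.
Proof.
move=> dy dE; rewrite /lie -dE.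
have cst e v : der (fun q => components d q (coord_field d e q)) y v = 0.
  apply: (@der_locally_cst _ _ _ _ _ _ (delta_mx 0 e)).
  by have := near_chart_dom dy; apply: filterS => q dq; rewrite vector_ofK.
exact: (etrans (congr2 (fun u v => u - v) (cst b _) (cst a _)) (subrr 0)).
Qed.

Lemma section_components_smooth {m : nat} {M : manifold R m} (F : M -> P) d
    (U : set M) s a : smooth_map F -> open U -> smooth_section F U s ->
  smooth_fun (U `&` F @^-1` chart_dom d) (fun q => components d (F q) (s q) 0 a : R).
Proof.
move=> sF oU ss c j.
have oi := section_domain_open sF c d oU.
by have /(Ck_mxP _ _ oi) h := ss c d j; have := h 0 a; rewrite -setIA.
Qed.

Lemma section_expansion {m : nat} {M : manifold R m} (F : M -> P) d s q :
  chart_dom d (F q) ->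
  s q = \sum_a components d (F q) (s q) 0 a *: coord_field d a (F q).
Proof. by move=> dq; rewrite -vector_of_delta // componentsK. Qed.

End CoordinateFields.

(** * The Levi-Civita connection of an induced metric *)

Section Dot.
Context {R : realType} {k : nat}.
Implicit Types u v w : 'rV[R]_k.

Lemma dotE u v : dot u v = \sum_i u 0 i * v 0 i.
Proof. by rewrite /dot mxE; apply: eq_bigr => i _; rewrite mxE. Qed.

Lemma dotC u v : dot u v = dot v u.
Proof. by rewrite !dotE; apply: eq_bigr => i _; rewrite mulrC. Qed.

Lemma dotDl u v w : dot (u + v) w = dot u w + dot v w.
Proof. by rewrite /dot mulmxDl mxE. Qed.

Lemma dotZl (a : R) u v : dot (a *: u) v = a * dot u v.
Proof. by rewrite /dot -scalemxAl mxE. Qed.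

Lemma dotZr (a : R) u v : dot u (a *: v) = a * dot u v.
Proof. by rewrite dotC dotZl dotC. Qed.

Lemma dotNl u v : dot (- u) v = - dot u v.
Proof. by rewrite -scaleN1r dotZl mulN1r. Qed.

Lemma dotBl u v w : dot (u - v) w = dot u w - dot v w.
Proof. by rewrite dotDl dotNl. Qed.

Lemma dot0l v : dot 0 v = 0.
Proof. by rewrite /dot mul0mx mxE. Qed.

Lemma dot_suml (I : Type) (r : seq I) (F : I -> 'rV[R]_k) v :
  dot (\sum_(i <- r) F i) v = \sum_(i <- r) dot (F i) v.
Proof. by rewrite /dot mulmx_suml summxE. Qed.

Lemma dot_sumr (I : Type) (r : seq I) (F : I -> 'rV[R]_k) v :
  dot v (\sum_(i <- r) F i) = \sum_(i <- r) dot v (F i).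
Proof. by rewrite dotC dot_suml; apply: eq_bigr => i _; rewrite dotC. Qed.

Lemma dot_eq0 u : dot u u = 0 -> u = 0.
Proof.
rewrite dotE => /eqP; rewrite psumr_eq0; last by move=> i _; rewrite -expr2 sqr_ge0.
move=> /allP h; apply/rowP => i; rewrite mxE; apply/eqP.
by have := h i; rewrite mem_index_enum mulf_eq0 orbb; apply.
Qed.

Lemma dot_comb (I : Type) (r : seq I) (c x : I -> R) (w y z : I -> 'rV[R]_k) u :
  (forall i, dot (z i) u = dot (y i) u) ->
  dot (\sum_(i <- r) c i *: w i + \sum_(i <- r) x i *: z i) u =
  dot (\sum_(i <- r) c i *: w i + \sum_(i <- r) x i *: y i) u.
Proof.
move=> zy; rewrite !dotDl; congr (_ + _); rewrite !dot_suml.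
by apply: eq_bigr => i _; rewrite !dotZl zy.
Qed.

Lemma dot_skew (p q r s t w : 'rV[R]_k) :
  dot p t + dot w q = dot r t + dot w s -> dot (r - p) t = - dot (s - q) w.
Proof.
rewrite ![dot w _]dotC !dotBl => E.
by rewrite opprB; apply/eqP; rewrite subr_eq addrAC eq_sym subr_eq addrC E addrC.
Qed.

End Dot.

(** The algebra in the uniqueness of the Levi-Civita connection: a cyclic tour of
    the permutations of the arguments comes back with the opposite sign. *)
Lemma koszul0 {R : realType} {I : Type} (S : I -> I -> I -> R) :
  (forall a b c, S a b c = S b a c) -> (forall a b c, S a b c = - S a c b) ->
  forall a b c, S a b c = 0.
Proof.
move=> sym skew a b c.
have : S a b c = - S a b c.
  by rewrite {1}sym skew sym skew opprK sym skew.
by move/eqP; rewrite -addr_eq0 -mulr2n mulrn_eq0 /= => /eqP.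
Qed.

Section InducedMetric.
Context {R : realType} {k l : nat} {P : manifold R k}.
Variables (f : P -> 'rV[R]_l) (sf : smooth_fun setT f).
Variable D : (P -> 'rV[R]_k) -> P -> 'rV[R]_k -> 'rV[R]_k.
Hypothesis hD : levi_civita (fun y u v => dot (der f y u) (der f y v)) D.

Lemma smooth_differentiable y : differentiable_at f y.
Proof. exact: (smooth_fun_differentiable_at sf). Qed.

Lemma der_field_differentiable y Z : field_near y Z ->
  differentiable_at (fun q => der f q (Z q)) y.
Proof.
move=> [U [oU Uy] sZ]; apply: (smooth_fun_differentiable_at (U := U)) => //.
apply: der_field_smooth => //; exact: smooth_fun_sub sf.
Qed.

Lemma is_derive_dot_field y v Z Z' : field_near y Z -> field_near y Z' ->
  der (fun q => dot (der f q (Z q)) (der f q (Z' q))) y v =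
  dot (der (fun q => der f q (Z q)) y v) (der f y (Z' y)) +
  dot (der f y (Z y)) (der (fun q => der f q (Z' q)) y v).
Proof.
move=> nZ nZ'.
have d1 := is_derive_der v (der_field_differentiable nZ).
have d2 := is_derive_der v (der_field_differentiable nZ').
have [_ E] := is_derive_dot d1 d2.
rewrite /= chart_coordK in E; last exact: chart_at_dom.
exact: E.
Qed.

(** The Levi-Civita derivative for the metric pulled back along [f] is the
    tangential part of the derivative in the ambient Euclidean space: by the
    symmetry of second derivatives the difference of the two sides is, on
    coordinate fields, a form as in [koszul0]. *)
Lemma levi_civita_coord_field y b v u :
  dot (der f y (D (coord_field (chart_at y) b) y v)) (der f y u) =
  dot (der (fun q => der f q (coord_field (chart_at y) b q)) y v) (der f y u).
Proof.
have [cD compat tf] := hD; have [linD _ _ _] := cD.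
pose d := chart_at y; have dy : chart_dom d y := chart_at_dom y.
pose Z := coord_field d; have nZ a : field_near y (Z a) := coord_field_near a dy.
pose h a q := der f q (Z a q).
have dh a : differentiable_at (h a) y by exact: der_field_differentiable.
have Lf := der_linear (smooth_differentiable y).
pose S a b c := dot (der f y (D (Z b) y (Z a y)) - der (h b) y (Z a y)) (h c y).
have lie0 a c : lie (Z a) (Z c) y = 0 by exact: lie_coord_field.
have S0 : forall a b c, S a b c = 0.
  apply: (koszul0 (S := S)) => a b' c.
    have od : open (chart_dom d) by exact: chart_dom_open.
    have e1 : der (h b') y (Z a y) = der (h a) y (Z b' y).
      have sfd : smooth_fun (chart_dom d) f by exact: smooth_fun_sub sf.
      have := der_lie od dy sfd (coord_field_vector_field d a)
        (coord_field_vector_field d b').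
      rewrite lie0 (linear_fun0 Lf).
      by move/eqP; rewrite subr_eq0 => /eqP.
    have e2 : D (Z b') y (Z a y) = D (Z a) y (Z b' y).
      have := tf _ _ y (nZ a) (nZ b'); rewrite /torsion lie0 subr0.
      by move/eqP; rewrite subr_eq0 => /eqP.
    exact: (congr2 (fun z w => dot (der f y z - w) (h c y)) e2 e1).
  have E := etrans (esym (is_derive_dot_field (Z a y) (nZ b') (nZ c)))
    (compat _ _ y (Z a y) (nZ b') (nZ c)).
  exact: dot_skew E.
have Zd a : Z a y = delta_mx 0 a by exact: vector_of_chart_at.
apply/eqP; rewrite -subr_eq0 -dotBl; apply/eqP.
rewrite [u]row_sum_delta (linear_fun_sum _ _ _ Lf) dot_sumr big1 // => c _.
rewrite dotZr -Zd [v]row_sum_delta.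
rewrite (linear_fun_sum _ _ _ (linD _ y (nZ b))) (linear_fun_sum _ _ _ Lf).
rewrite (linear_fun_sum _ _ _ (der_linear (dh b))) -sumrB dot_suml big1 ?mulr0 // => a _.
rewrite -scalerBr dotZl -Zd.
by have := S0 a b c; rewrite /S => ->; rewrite mulr0.
Qed.

Section Pullback.
Context {m : nat} {M : manifold R m}.
Variables (G : M -> P) (sG : smooth_map G).
Variable DG : (M -> 'rV[R]_k) -> M -> 'rV[R]_m -> 'rV[R]_k.
Hypothesis hDG : pullback_connection G D DG.

(** A section along [G] is a combination of coordinate fields composed with [G]; on
    these the pullback connection is given by [D], hence by the ambient derivative. *)
Lemma pullback_levi_civita p s v u : section_near G p s ->
  dot (der f (G p) (DG s p v)) (der f (G p) u) =
  dot (der (fun q => der f (G q) (s q)) p v) (der f (G p) u).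
Proof.
move=> ns; have [cDG DGZ] := hDG.
pose d := chart_at (G p); have dp : chart_dom d (G p) := chart_at_dom (G p).
pose Z := coord_field d; pose x a q : R := components d (G q) (s q) 0 a.
pose h a q := der f q (Z a q).
have Lf q := der_linear (smooth_differentiable q).
have nd : \forall q \near p, chart_dom d (G q) by exact: near_map (near_chart_dom dp).
have nx a : fun_near p (x a).
  have [U [oU Up] ss] := ns; exists (U `&` G @^-1` chart_dom d).
    split=> //; apply: openI => //; apply: open_preimage => //.
    exact: chart_dom_open.
  exact: section_components_smooth.
have nZG a : section_near G p (Z a \o G).
  exists (G @^-1` chart_dom d); last exact: coord_field_section.
  by split=> //; apply: open_preimage => //; exact: chart_dom_open.
have sx : \forall q \near p, s q = \sum_a x a q *: (Z a \o G) q.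
  by apply: filterS nd => q dq; exact: section_expansion.
have DGs := connection_expand sG cDG v ns nx nZG sx.
have e : \forall q \near p, (\sum_a (fun q => x a q *: h a (G q))) q = der f (G q) (s q).
  apply: filterS sx => q ->; rewrite fct_sumE (linear_fun_sum _ _ _ (Lf _)).
  by [].
have dx a : differentiable_at (x a) p.
  by have [U [_ Up] sU] := nx a; exact: smooth_fun_differentiable_at Up.
have dh a : differentiable_at (h a) (G p).
  exact/der_field_differentiable/coord_field_near.
have dhG a : differentiable_at (h a \o G) p by exact: differentiable_at_comp.
have der1 a : is_derive (chart_coord (chart_at p) p) v
    ((fun q => x a q *: h a (G q)) \o chart_param (chart_at p))
    (der (x a) p v *: h a (G p) + x a p *: der (h a) (G p) (tangent_map G p v)).
  have := is_derive_scale (is_derive_der v (dx a)) (is_derive_der v (dhG a)).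
  rewrite /= chart_coordK; last exact: chart_at_dom.
  by rewrite -der_comp.
have [_ derS] := is_derive_sum der1.
have e' := near_param (chart_at_dom p) e.
have -> : der (fun q => der f (G q) (s q)) p v = \sum_a (der (x a) p v *: h a (G p) +
    x a p *: der (h a) (G p) (tangent_map G p v)).
  rewrite -derS /der; apply: esym; apply: near_eq_derive.
  by apply: filterS e' => z E; apply: (etrans _ E); rewrite !fct_sumE.
rewrite DGs big_split /= big_split /= .
have -> : \sum_a der (x a) p v *: (Z a \o G) p + \sum_a x a p *: DG (Z a \o G) p v =
  1 *: (\sum_a der (x a) p v *: Z a (G p)) + \sum_a x a p *: DG (Z a \o G) p v.
  by rewrite scale1r.
have Lsum c w := linear_fun_sum (index_enum 'I_k) c w (Lf (G p)).
have -> : der f (G p) (1 *: (\sum_a der (x a) p v *: Z a (G p)) +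
    \sum_a x a p *: DG (Z a \o G) p v) =
  \sum_a der (x a) p v *: h a (G p) + \sum_a x a p *: der f (G p) (DG (Z a \o G) p v).
  by apply: etrans (Lf (G p) _ _ _) _; rewrite scale1r; apply: (congr2 +%R); exact: Lsum.
apply: dot_comb => a.
have nZ : field_near (G p) (Z a) by exact: coord_field_near.
have e1 := congr1 (fun w => dot (der f (G p) w) (der f (G p) u)) (DGZ _ p v nZ).
apply: (etrans e1).
exact: (levi_civita_coord_field (G p) a (tangent_map G p v) u).
Qed.

End Pullback.
End InducedMetric.

(** * The projected connection of a hypersurface *)

Lemma unitmx_of_inj {R : fieldType} {n : nat} (A : 'M[R]_n) :
  (forall u : 'rV_n, u *m A = 0 -> u = 0) -> A \in unitmx.
Proof. by move=> iA; rewrite -row_free_unit; exact: inj_row_free. Qed.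

Section Ambient.
Context {R : realType} {n : nat} {Mt : weitzenbock R n}.
Implicit Types (q : Mt) (d : chart Mt).

Lemma coefK q v : coef q v *m frame_mx q = v.
Proof. by rewrite /coef mulmxKV //; exact: frame_basis. Qed.

Lemma mul_frameK q w : coef q (w *m frame_mx q) = w.
Proof. by rewrite /coef mulmxK //; exact: frame_basis. Qed.

Lemma coef_inj0 q v : coef q v = 0 -> v = 0.
Proof. by move=> v0; rewrite -(coefK q v) v0 mul0mx. Qed.

(** The parallel frame in the coordinates of a chart. It is smooth and invertible, so
    that coefficients relative to the frame are smooth where components are. *)
Definition chart_frame d q : 'M[R]_n.+1 := \matrix_i components d q (frame i q).

Lemma components_coef d q w : chart_dom d q ->
  components d q w = coef q w *m chart_frame d q.
Proof.
move=> dq; rewrite -{1}(coefK q w) mulmx_sum_row.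
rewrite (linear_fun_sum _ _ _ (components_linear dq)) mulmx_sum_row.
by apply: eq_bigr => i _; rewrite !rowK.
Qed.

Lemma chart_frame_unit d q : chart_dom d q -> chart_frame d q \in unitmx.
Proof.
move=> dq; apply: unitmx_of_inj => u u0.
have : components d q (u *m frame_mx q) = 0 by rewrite components_coef // mul_frameK.
move/(congr1 (vector_of d q)); rewrite componentsK // (linear_fun0 (vector_of_linear dq)).
by move/(congr1 (coef q)); rewrite mul_frameK /coef mul0mx.
Qed.

Lemma chart_frame_smooth d k :
  Ck k (chart_coord d @` chart_dom d) (chart_frame d \o chart_param d).
Proof.
have oi := @chart_codom_open _ _ _ d; apply/Ck_mxP => // i j.
have sub : chart_coord d @` chart_dom d `<=`
    chart_coord d @` (chart_dom d `&` setT `&` (@idfun Mt) @^-1` chart_dom d).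
  by move=> x [q dq <-]; exists q.
have := Ck_sub sub (frame_smooth i d d k).
move=> /(Ck_mxP _ _ oi) h; have hj := h 0 j.
by apply: Ck_eq hj => // x _; rewrite /chart_frame /= mxE.
Qed.

End Ambient.

Section Hypersurface.
Context {R : realType} {n : nat} {Mt : weitzenbock R n} {M : hypersurface Mt}.
Implicit Types (p q : M) (X Y : M -> 'rV[R]_n).

Local Notation iota := (@Defs.incl R n Mt M).
Local Notation diota := (tangent_map iota).
Local Notation met := (@hmetric R n Mt M).

(** The matrix of the inclusion of a tangent space of the hypersurface in the
    ambient one, the latter being identified with the Euclidean space by means
    of the parallel frame. *)
Definition incl_mx p : 'M[R]_(n, n.+1) :=
  \matrix_i coef (iota p) (diota p (delta_mx 0 i)).

Lemma diota_linear p : linear (diota p).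
Proof. exact/tangent_map_linear/incl_smooth. Qed.

Lemma coef_diota p v : coef (iota p) (diota p v) = v *m incl_mx p.
Proof.
rewrite {1}[v]row_sum_delta (linear_fun_sum _ _ _ (diota_linear p)) mulmx_sum_row.
rewrite /coef mulmx_suml; apply: eq_bigr => i _.
by rewrite rowK -scalemxAl.
Qed.

Lemma hmetricE p u v : met p u v = dot (u *m incl_mx p) (v *m incl_mx p).
Proof. by rewrite /hmetric /wmetric !coef_diota. Qed.

Lemma incl_mx_inj p (u : 'rV[R]_n) : u *m incl_mx p = 0 -> u = 0.
Proof.
rewrite -coef_diota => /coef_inj0 h.
by have [_ im _] := @incl_embedding R n Mt M; exact: im h.
Qed.

Lemma dot_mulmx {a b : nat} (u : 'rV[R]_a) (v : 'rV[R]_b) (A : 'M[R]_(a, b)) :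
  dot (u *m A) v = dot u (v *m A^T).
Proof. by rewrite /dot trmx_mul trmxK mulmxA. Qed.

Lemma gramE p : gram met p = incl_mx p *m (incl_mx p)^T.
Proof.
apply/matrixP => i j; rewrite mxE hmetricE -!rowE /dot !mxE.
by apply: eq_bigr => k _; rewrite !mxE.
Qed.

Lemma gram_unit p : gram met p \in unitmx.
Proof.
apply: unitmx_of_inj => u; rewrite gramE mulmxA => u0.
by apply: (@incl_mx_inj p); apply: dot_eq0; rewrite dot_mulmx u0 dotC dot0l.
Qed.

(** The orthogonal projection onto the tangent space, a left inverse of
    [incl_mx] in the convention of matrices acting on the right. *)
Definition proj_mx p : 'M[R]_(n.+1, n) := (incl_mx p)^T *m invmx (gram met p).

Lemma incl_projK p : incl_mx p *m proj_mx p = 1%:M.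
Proof. by rewrite /proj_mx mulmxA -gramE mulmxV // gram_unit. Qed.

(** In the parallelization by the ambient frame, the flat connection is the
    derivative of vector-valued functions. *)
Lemma nablaE Y p v : nabla Y p v = der (fun q => Y q *m incl_mx q) p v *m proj_mx p.
Proof.
rewrite /nabla /tangential /sharp /proj_mx mulmxA; congr (_ *m _).
apply/rowP => i; rewrite mxE /wmetric /wnabla mul_frameK coef_diota -rowE.
have -> : (fun q => coef (iota q) (diota q (Y q))) = fun q => Y q *m incl_mx q.
  by apply/funext => q; rewrite coef_diota.
by rewrite dotE mxE; apply: eq_bigr => k _; rewrite !mxE.
Qed.

(** In charts the coefficients are the components of the image of the field times the
    inverse of the matrix of the ambient frame. *)
Lemma incl_field_differentiable p Y : field_near p Y ->
  differentiable_at (fun q => Y q *m incl_mx q) p.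
Proof.
move=> [U [oU Up] sY]; pose c := chart_at p; pose d := chart_at (iota p).
have sI := @incl_smooth R n Mt M.
have cp : chart_dom c p := chart_at_dom p.
have dp : chart_dom d (iota p) := chart_at_dom (iota p).
have oi := section_domain_open sI c d oU.
have pi : (chart_coord c @` (chart_dom c `&` U `&` iota @^-1` chart_dom d))
    (chart_coord c p) by exists p.
suff [df _] : Ck 1 (chart_coord c @` (chart_dom c `&` U `&` iota @^-1` chart_dom d))
    ((fun q => Y q *m incl_mx q) \o chart_param c) by exact: df pi.
apply: (Ck_eq (f := fun x =>
  components d (iota (chart_param c x)) (diota (chart_param c x) (Y (chart_param c x)))
  *m invmx (chart_frame d (iota (chart_param c x))))) => //.
  move=> x /section_domainP[cx Ux dx xK].
  by rewrite components_coef // mulmxK ?chart_frame_unit // coef_diota.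
apply: Ck_mulmx => //; first exact: (tangent_map_section sI oU sY c d 1).
apply: Ck_invmx => // [x /section_domainP[cx Ux dx xK]|].
  exact: chart_frame_unit.
have od := @chart_codom_open _ _ _ d.
apply: (Ck_eq (f := (chart_frame d \o chart_param d) \o
    (chart_coord d \o iota \o chart_param c))) => //.
  by move=> x /section_domainP[cx Ux dx xK]; rewrite /= chart_coordK.
apply: (Ck_comp oi od); last exact: chart_frame_smooth.
  move=> x /section_domainP[cx Ux dx xK].
  by exists (iota (chart_param c x)).
have [_ /(_ c d 1%N)] := sI; apply: Ck_sub => x [q [[cq Uq] dq] <-].
by exists q.
Qed.

Lemma is_derive_incl_field p v Y : field_near p Y ->
  is_derive (chart_coord (chart_at p) p) v
    ((fun q => Y q *m incl_mx q) \o chart_param (chart_at p))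
    (der (fun q => Y q *m incl_mx q) p v).
Proof. by move=> nY; apply/is_derive_der/incl_field_differentiable. Qed.

Lemma dot_proj p w x : dot (w *m proj_mx p *m incl_mx p) (x *m incl_mx p) =
  dot w (x *m incl_mx p).
Proof.
rewrite /dot trmx_mul /proj_mx !mulmxA -(mulmxA _ (incl_mx p) (incl_mx p)^T) -gramE.
by rewrite mulmxKV ?gram_unit.
Qed.

Lemma nabla_metric p v X Y : field_near p X -> field_near p Y ->
  der (fun q => met q (X q) (Y q)) p v =
  met p (nabla X p v) (Y p) + met p (X p) (nabla Y p v).
Proof.
move=> nX nY; have -> : (fun q => met q (X q) (Y q)) =
    fun q => dot (X q *m incl_mx q) (Y q *m incl_mx q).
  by apply/funext => q; exact: hmetricE.
have [_ E] := is_derive_dot (is_derive_incl_field v nX) (is_derive_incl_field v nY).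
apply: (etrans E); rewrite /= chart_coordK; last exact: chart_at_dom.
rewrite !hmetricE !nablaE dot_proj; congr (_ + _).
by rewrite [RHS]dotC dot_proj dotC.
Qed.

(** The expansion [connection_expand], here from the definition of [nabla]. *)
Lemma nabla_expand p v (I : finType) t (f : I -> M -> R) (s : I -> M -> 'rV[R]_n) :
  (forall i, fun_near p (f i)) -> (forall i, field_near p (s i)) ->
  (\forall q \near p, t q = \sum_i f i q *: s i q) ->
  nabla t p v = \sum_i (der (f i) p v *: s i p + f i p *: nabla (s i) p v).
Proof.
move=> nf ns ts.
have df i : differentiable_at (f i) p.
  by have [U [_ Up] sU] := nf i; exact: smooth_fun_differentiable_at Up.
have d1 i := is_derive_scale (is_derive_der v (df i)) (is_derive_incl_field v (ns i)).
have Dn : is_derive (chart_coord (chart_at p) p) v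
    (\sum_(i <- index_enum I) (fun z => (f i \o chart_param (chart_at p)) z *:
      ((fun q => s i q *m incl_mx q) \o chart_param (chart_at p)) z))
    (\sum_i (der (f i) p v *: (s i p *m incl_mx p) +
       f i p *: der (fun q => s i q *m incl_mx q) p v)).
  elim: (index_enum I) => [|i r IH]; first by rewrite !big_nil; exact: is_derive_cst.
  have di := d1 i; rewrite /= chart_coordK in di; last exact: chart_at_dom.
  by rewrite !big_cons; exact: (is_deriveD di IH).
have [_ E] := Dn.
have e : \forall q \near p,
    (\sum_(i <- index_enum I) (fun q => f i q *: (s i q *m incl_mx q))) q =
    t q *m incl_mx q.
  apply: filterS ts => q ->; rewrite fct_sumE mulmx_suml.
  by apply: eq_bigr => i _; rewrite scalemxAl.
rewrite nablaE.
have -> : der (fun q => t q *m incl_mx q) p v =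
    \sum_i (der (f i) p v *: (s i p *m incl_mx p) +
       f i p *: der (fun q => s i q *m incl_mx q) p v).
  rewrite -E /der; apply: esym; apply: near_eq_derive.
  have := near_param (chart_at_dom p) e.
  by apply: filterS => z ez; apply: (etrans _ ez); rewrite !fct_sumE.
rewrite mulmx_suml; apply: eq_bigr => i _.
by rewrite mulmxDl nablaE -!scalemxAl -mulmxA incl_projK mulmx1.
Qed.

End Hypersurface.

(** * The Weingarten and Codazzi equations of the Gauss map *)

Lemma derN {R : realType} {m a b : nat} {M : manifold R m} (f : M -> 'M[R]_(a, b)) p v :
  differentiable_at f p -> der (fun q => - f q) p v = - der f p v.
Proof. by move=> df; apply: deriveN; exact: diff_derivable. Qed.

Section GaussMap.
Context {R : realType} {n : nat} {Mt : weitzenbock R n} {M : hypersurface Mt}.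
Local Notation iota := (@Defs.incl R n Mt M).
Local Notation met := (@hmetric R n Mt M).
Variables (N : M -> 'rV[R]_n.+1) (hN : unit_normal N).
Variables (W : M -> 'M[R]_n) (hW : weingarten N W).
Variables (Sn : sphere R n) (g : M -> Sn) (hg : gauss_map N g).

Local Notation incS := (@sphere_incl R n Sn).

(** The Gauss map, seen in the Euclidean space. *)
Definition normal_coef q : 'rV[R]_n.+1 := coef (iota q) (N q).

Lemma normal_coefE : normal_coef = incS \o g.
Proof. by have [_ e] := hg; apply/funext => q; rewrite /= e. Qed.

Lemma normal_coef_smooth : smooth_fun setT normal_coef.
Proof.
rewrite normal_coefE; have [sg _] := hg.
exact: (smooth_fun_comp sg openT (@sphere_incl_smooth R n Sn)).
Qed.

Lemma normal_coef_differentiable q : differentiable_at normal_coef q.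
Proof. exact: (smooth_fun_differentiable_at normal_coef_smooth). Qed.

Lemma normal_coef1 q : dot (normal_coef q) (normal_coef q) = 1.
Proof. by have [_ h _ _] := hN; exact: h. Qed.

Lemma normal_coef_orth q v : dot (normal_coef q) (v *m incl_mx q) = 0.
Proof. by have [_ _ h _] := hN; rewrite -coef_diota; exact: h. Qed.

Lemma der_dot_cst (f h : M -> 'rV[R]_n.+1) (a : R) q v :
  differentiable_at f q -> differentiable_at h q ->
  (\forall z \near q, dot (f z) (h z) = a) ->
  dot (der f q v) (h q) + dot (f q) (der h q v) = 0.
Proof.
move=> df dh fh.
have [_ E] := is_derive_dot (is_derive_der v df) (is_derive_der v dh).
rewrite /= chart_coordK in E; last exact: chart_at_dom.
by rewrite -E; exact: (der_locally_cst v fh).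
Qed.

(** The normal and the images of the coordinate vectors form a basis: their Gram
    matrix is block diagonal and invertible. *)
Lemma normal_split0 q (w : 'rV[R]_n.+1) :
  w *m (incl_mx q)^T = 0 -> dot w (normal_coef q) = 0 -> w = 0.
Proof.
move=> wJ wN; pose B : 'M[R]_(1 + n, n.+1) := col_mx (normal_coef q) (incl_mx q).
have BB : B *m B^T = block_mx 1 0 0 (gram met q).
  rewrite /B tr_col_mx mul_col_row; congr block_mx.
  - by rewrite [LHS]mx11_scalar -[X in X%:M]/(dot _ _) normal_coef1.
  - apply/rowP => j; rewrite [RHS]mxE -(normal_coef_orth q (delta_mx 0 j)) /dot -rowE !mxE.
    by apply: eq_bigr => k _; rewrite !mxE.
  - apply/colP => j; rewrite [RHS]mxE -(normal_coef_orth q (delta_mx 0 j)) /dot -rowE !mxE.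
    by apply: eq_bigr => k _; rewrite !mxE mulrC.
  - by rewrite gramE.
have uB : B \in unitmx.
  have : B *m B^T \in unitmx.
    by rewrite BB unitmxE det_ublock det1 mul1r -unitmxE gram_unit.
  by rewrite unitmx_mul => /andP[].
have wB : w *m B^T = 0.
  rewrite /B tr_col_mx mul_mx_row wJ.
  have -> : w *m (normal_coef q)^T = 0.
    by rewrite [LHS]mx11_scalar -[X in X%:M]/(dot _ _) wN raddf0.
  by rewrite row_mx0.
have uBt : B^T \in unitmx by rewrite unitmx_tr.
by rewrite -[w](mulmxK uBt) wB mul0mx.
Qed.

(** Identities stated for fields are applied to single tangent vectors this way. *)
Lemma field_through (q : M) (y : 'rV[R]_n) : exists2 Y, field_near q Y & Y q = y.
Proof.
have cq : chart_dom (chart_at q) q := chart_at_dom q.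
exists (fun z => \sum_a y 0 a *: coord_field (chart_at q) a z).
  apply: (section_near_sum (@id_smooth_map _ _ _)) => a.
  apply: (section_nearZ (@id_smooth_map _ _ _)).
    exists setT; first by split=> //; exact: openT.
    exact: (smooth_fun_locally_cst (a := y 0 a) openT).
  exact: coord_field_near.
by rewrite -vector_of_delta // vector_of_chart_at.
Qed.

(** The Weingarten equation, from the derivatives of [<N, N> = 1] and, for the
    tangential part, of [<N, Y> = 0]. *)
Lemma der_normal_coef q x : der normal_coef q x = - (x *m W q *m incl_mx q).
Proof.
have [_ wW] := hW; have dN := normal_coef_differentiable q.
apply/eqP; rewrite -subr_eq0 opprK; apply/eqP; apply: (normal_split0 (q := q)).
  apply/rowP => i; rewrite [RHS]mxE.
  have [Y nY Yq] := field_through q (delta_mx 0 i).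
  have dY := incl_field_differentiable nY.
  have orth : \forall z \near q, dot (normal_coef z) (Y z *m incl_mx z) = 0.
    by apply: nearW => z; exact: normal_coef_orth.
  have E := der_dot_cst x dN dY orth.
  have := wW Y q x nY; rewrite hmetricE /wmetric /wnabla mul_frameK.
  have -> : (fun z => coef (iota z) (tangent_map iota z (Y z))) = fun z => Y z *m incl_mx z.
    by apply/funext => z; rewrite coef_diota.
  move=> E'; move: E; rewrite -[coef _ _]/(normal_coef q) in E' *.
  rewrite -E' -dotDl Yq => E; rewrite -[RHS]E -rowE /dot !mxE.
  by apply: eq_bigr => k _; rewrite !mxE.
have one : \forall z \near q, dot (normal_coef z) (normal_coef z) = 1.
  by apply: nearW => z; exact: normal_coef1.
have := der_dot_cst x dN dN one; rewrite [dot _ (der _ _ _)]dotC -mulr2n => /eqP.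
rewrite mulrn_eq0 /= => /eqP E.
by rewrite dotDl E add0r dotC normal_coef_orth.
Qed.

(** The Codazzi equation: the normal is a vector-valued function, and the
    commutator of its derivatives along [X] and [Y] is its derivative along the
    bracket; the Weingarten equation turns this into a statement on [W]. *)
Lemma codazzi (U : set M) X Y p : open U -> U p ->
  vector_field U X -> vector_field U Y ->
  nabla (fun q => Y q *m W q) p (X p) - nabla (fun q => X q *m W q) p (Y p) =
  lie X Y p *m W p.
Proof.
move=> oU Up sX sY; have [tW _] := hW.
have near_field Z : vector_field U Z -> field_near p (fun q => Z q *m W q).
  by move=> sZ; exists U; [exact: conj oU Up|exact: tW].
have dZ Z v : vector_field U Z ->
    der (fun q => der normal_coef q (Z q)) p v =
    - der (fun q => Z q *m W q *m incl_mx q) p v.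
  move=> sZ; rewrite -derN; last exact/incl_field_differentiable/near_field.
  by congr (der _ p v); apply/funext => q; exact: der_normal_coef.
have sN : smooth_fun U normal_coef by exact: smooth_fun_sub normal_coef_smooth.
have E := der_lie oU Up sN sX sY.
rewrite !nablaE -mulmxBl -[RHS]mulmx1 -(incl_projK p) mulmxA; congr (_ *m _).
apply: oppr_inj; apply: etrans (der_normal_coef p (lie X Y p)); apply: etrans E.
apply: esym; apply: (etrans (congr2 (fun u v => u - v) (dZ Y (X p) sY) (dZ X (Y p) sX))).
by rewrite opprB addrC opprK.
Qed.

Section Laplacian.
Variables (nablaSn : (Sn -> 'rV[R]_n) -> Sn -> 'rV[R]_n -> 'rV[R]_n).
Hypothesis hnablaSn : levi_civita (@round_metric R n Sn) nablaSn.
Variables (nablag : (M -> 'rV[R]_n) -> M -> 'rV[R]_n -> 'rV[R]_n).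
Hypothesis hnablag : pullback_connection g nablaSn nablag.
Variables (phi : M -> 'M[R]_n) (hphi : identification g phi).

Lemma incS_linear q : linear (der incS (g q)).
Proof.
apply: der_linear; exact: (smooth_fun_differentiable_at (@sphere_incl_smooth R n Sn)).
Qed.

Lemma incS_inj q u v : der incS (g q) u = der incS (g q) v -> u = v.
Proof.
move=> uv; have [_ im _] := @sphere_incl_embedding R n Sn.
apply/eqP; rewrite -subr_eq0; apply/eqP; apply: (im (g q)).
rewrite addrC -scaleN1r (incS_linear q) scaleN1r uv.
by rewrite addNr.
Qed.

Lemma der_incS_phi q v : der incS (g q) (v *m phi q) = v *m incl_mx q.
Proof. by rewrite hphi coef_diota. Qed.

Lemma phi_unit q : phi q \in unitmx.
Proof.
apply: unitmx_of_inj => u u0; apply: (@incl_mx_inj _ _ _ _ q).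
by rewrite -der_incS_phi u0 (linear_fun0 (incS_linear q)).
Qed.

Lemma der_incS_tangent_map q x : der incS (g q) (tangent_map g q x) = der normal_coef q x.
Proof.
have [sg _] := hg; rewrite der_comp //; first by rewrite normal_coefE.
exact: (smooth_fun_differentiable_at (@sphere_incl_smooth R n Sn)).
Qed.

Lemma tangent_map_gauss q x : tangent_map g q x = - (x *m W q) *m phi q.
Proof.
apply: (@incS_inj q); rewrite der_incS_tangent_map der_normal_coef der_incS_phi.
by rewrite mulNmx.
Qed.

(** The identification [phi] carries [nabla] to the pullback of the connection of the
    sphere, both being tangential parts of the derivative in the same Euclidean
    space, and it carries [- W] to the differential of the Gauss map. *)
Lemma nablag_gauss (U : set M) Y p v : open U -> U p -> vector_field U Y ->
  nablag (fun q => tangent_map g q (Y q)) p v =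
  - nabla (fun q => Y q *m W q) p v *m phi p.
Proof.
move=> oU Up sY; have [tW _] := hW; have [sg _] := hg.
set r := nablag _ p v.
have nYW : field_near p (fun q => Y q *m W q).
  by exists U; [exact: conj oU Up|exact: tW].
have ns : section_near g p (fun q => tangent_map g q (Y q)).
  by exists U; [exact: conj oU Up|exact: tangent_map_section].
pose z := r *m invmx (phi p); have rz : r = z *m phi p by rewrite mulmxKV ?phi_unit.
suff zE : z = - nabla (fun q => Y q *m W q) p v by rewrite rz zE.
apply/eqP; rewrite -subr_eq0 opprK; apply/eqP.
apply: (@incl_mx_inj _ _ _ _ p); apply: dot_eq0.
set w := z + _.
have key x : dot (z *m incl_mx p) (x *m incl_mx p) =
    - dot (nabla (fun q => Y q *m W q) p v *m incl_mx p) (x *m incl_mx p).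
  have := pullback_levi_civita (@sphere_incl_smooth R n Sn) hnablaSn sg hnablag v
    (x *m phi p) ns.
  rewrite -/r rz !der_incS_phi => ->.
  rewrite -dotNl nablaE [in RHS]dotNl dot_proj -dotNl; congr (dot _ _).
  rewrite -derN; last exact: incl_field_differentiable.
  congr (der _ p v); apply/funext => q.
  by rewrite der_incS_tangent_map der_normal_coef.
by rewrite [X in dot X _]mulmxDl dotDl key addNr.
Qed.

(** For [D] equal to [nabla] the right-hand side is the divergence of [W]. *)
Lemma laplacian_gauss (U : set M) (E : 'I_n -> M -> 'rV[R]_n) D p :
  open U -> U p -> (forall i, vector_field U (E i)) ->
  - (laplacian E g nablag D p *m invmx (phi p)) =
  \sum_i (nabla (fun q => E i q *m W q) p (E i p) - D (E i) p (E i p) *m W p).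
Proof.
move=> oU Up sE; rewrite /laplacian mulmx_suml -sumrN; apply: eq_bigr => i _.
rewrite (nablag_gauss _ oU Up (sE i)) tangent_map_gauss -mulmxBl mulmxK ?phi_unit //.
by rewrite opprB opprK addrC.
Qed.

End Laplacian.
End GaussMap.

(** * Divergences in terms of connection matrices *)

Lemma row_sub {R : pzRingType} {m n : nat} (A B : 'M[R]_(m, n)) i :
  row i (A - B) = row i A - row i B.
Proof. exact: linearB. Qed.

Section FrameAlgebra.
Context {R : realFieldType} {n : nat}.
Variables (G K dw : 'I_n -> 'M[R]_n) (w : 'M[R]_n).

(** In a frame, [G k] and [K k] are the matrices of two connections in the
    direction of the [k]-th vector and [w], [dw k] those of an operator and of the
    derivatives of its entries. When the second connection is torsion-free, this is
    the torsion of the first one on the [k]-th and [j]-th vectors. *)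
Definition frame_torsion k j : 'rV[R]_n := row j (G k - K k) - row k (G j - K j).

Lemma frame_torsionE k j :
  frame_torsion k j = row j (G k) - row k (G j) - (row j (K k) - row k (K j)).
Proof. by apply/rowP => i; rewrite !mxE; ring. Qed.

(** The divergence of the operator with matrix [a] for the connection [H]. *)
Definition frame_div (H : 'I_n -> 'M[R]_n) (a : 'M[R]_n) (da : 'I_n -> 'M[R]_n) :
    'rV[R]_n :=
  \sum_i (row i (da i + a *m H i) - row i (H i) *m a).

(** The matrix of [HI + 2W^a] when [x] is that of [W]. *)
Definition trace_skew (x : 'M[R]_n) : 'M[R]_n := (\tr x)%:M + (x - x^T).

Hypothesis skewG : forall k, (G k)^T = - G k.
Hypothesis skewK : forall k, (K k)^T = - K k.
Hypothesis codazziG : forall k j,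
  row j (dw k + w *m G k) - row k (dw j + w *m G j) =
  (row j (K k) - row k (K j)) *m w.

(** The covariant derivative of the operator. *)
Let C i := dw i + w *m G i - G i *m w.

Lemma frame_divE H a da :
  frame_div H a da = \sum_i row i (da i + a *m H i - H i *m a).
Proof. by apply: eq_bigr => i _; rewrite linearB /= row_mul. Qed.

Definition frame_trWT : 'rV[R]_n := \row_m \sum_j (frame_torsion m j *m w) 0 j.
Definition frame_trT : 'rV[R]_n := \row_m \sum_j frame_torsion m j 0 j.

Let sub_entry {a b : nat} (A B : 'M[R]_(a, b)) i j : (A - B) i j = A i j - B i j.
Proof. by rewrite !mxE. Qed.

Let add_entry {a b : nat} (A B : 'M[R]_(a, b)) i j : (A + B) i j = A i j + B i j.
Proof. by rewrite mxE. Qed.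

Let opp_entry {a b : nat} (A : 'M[R]_(a, b)) i j : (- A) i j = - A i j.
Proof. by rewrite mxE. Qed.

Let row_entry {a b : nat} (A : 'M[R]_(a, b)) i j : row i A 0 j = A i j.
Proof. by rewrite mxE. Qed.

(** The Codazzi equation for the covariant derivative: the bracket is expressed by the
    torsion. *)
Lemma frame_codazzi k j i : (frame_torsion k j *m w) 0 i = C j k i - C k j i.
Proof.
have := congr1 (fun r : 'rV_n => r 0 i) (codazziG k j).
rewrite /= mulmxBl -!row_mul !sub_entry !row_entry !add_entry.
rewrite /frame_torsion mulmxBl -!row_mul !mulmxBl !sub_entry !row_entry !sub_entry.
by move=> E; lra.
Qed.

(** The covariant derivative commutes with traces and, the connection being metric,
    with transposes. Hence the difference of the two divergences is that of [w^T] and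
    [tr w], which is the trace of the Codazzi equation. *)
Lemma frame_div_shape :
  frame_div G w dw = frame_div G (trace_skew w) (fun i => trace_skew (dw i)) + frame_trWT.
Proof.
have trace_skew_cov i :
    trace_skew (dw i) + trace_skew w *m G i - G i *m trace_skew w =
    (\tr (C i))%:M + (C i - (C i)^T).
  have -> : \tr (C i) = \tr (dw i).
    by rewrite /C linearB linearD /= [\tr (G i *m w)]mxtrace_mulC addrK.
  have -> : (C i)^T = (dw i)^T + w^T *m G i - G i *m w^T.
    rewrite /C linearB linearD /= !trmx_mul skewG mulNmx mulmxN opprK.
    by rewrite addrAC.
  rewrite /trace_skew /C mulmxDl mulmxDr mul_scalar_mx mul_mx_scalar !mulmxBl !mulmxBr.
  apply/matrixP => a b; rewrite !(add_entry, opp_entry). ring.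
have -> : frame_div G w dw = \sum_i row i (C i) by exact: frame_divE.
have -> : frame_div G (trace_skew w) (fun i => trace_skew (dw i)) =
    \sum_i row i ((\tr (C i))%:M + (C i - (C i)^T)).
  by rewrite frame_divE; apply: eq_bigr => i _; rewrite trace_skew_cov.
apply/rowP => m; rewrite add_entry !summxE mxE -big_split /=.
transitivity (\sum_i (C i i m + ((\tr (C i))%:M i m - C m i i))).
  have -> : \sum_i (C i i m + ((\tr (C i))%:M i m - C m i i)) =
      \sum_i C i i m + \sum_i ((\tr (C i))%:M i m - C m i i) by rewrite -big_split.
  have -> : \sum_i ((\tr (C i))%:M i m - C m i i) = 0.
    rewrite sumrB (bigD1 m) //= big1 ?addr0 => [|i im]; last by rewrite mxE (negPf im).
    by rewrite mxE eqxx mulr1n subrr.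
  by rewrite addr0; apply: eq_bigr => i _; exact: row_entry.
apply: eq_bigr => i _; rewrite frame_codazzi row_entry.
have -> (A : 'M[R]_n) (s : R) : (s%:M + (A - A^T)) i m = s%:M i m + (A i m - A m i).
  by rewrite !mxE.
by ring.
Qed.

(** The trace of [T (x, .)] has two halves, of which one vanishes because the
    difference of two metric connections is skew. *)
Lemma frame_trTE : frame_trT = \sum_i row i (G i - K i).
Proof.
have skew0 k j : (G k - K k) j j = 0.
  have := congr1 (fun A : 'M[R]_n => A j j) (skewG k); rewrite !mxE => e1.
  have := congr1 (fun A : 'M[R]_n => A j j) (skewK k); rewrite !mxE => e2.
  lra.
apply/rowP => m; rewrite mxE summxE; apply: eq_bigr => j _.
rewrite !mxE; have := skew0 m j; rewrite !mxE => ->.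
have := congr1 (fun A : 'M[R]_n => A m j) (skewG j); rewrite !mxE => ->.
have := congr1 (fun A : 'M[R]_n => A m j) (skewK j); rewrite !mxE => ->.
ring.
Qed.

Lemma frame_div_change a da : frame_div G a da =
  frame_div K a da + \sum_i row i (a *m (G i - K i)) - frame_trT *m a.
Proof.
rewrite frame_trTE mulmx_suml /frame_div -big_split /= -sumrB; apply: eq_bigr => i _.
rewrite [row i (G i - K i)]row_sub mulmxBr mulmxBl.
apply/rowP => m; rewrite !(add_entry, opp_entry, row_entry); ring.
Qed.

(** The multiple of the identity in [trace_skew w] contributes nothing, by
    [frame_trTE]; against the skew matrix [w - w^T], the difference of the connections
    only counts through its antisymmetrization, that is, the torsion. *)
Lemma frame_trTWa :
  \sum_i row i (trace_skew w *m (G i - K i)) - frame_trT *m trace_skew w =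
  \sum_i \sum_j (2^-1 * (w - w^T) i j) *: frame_torsion i j - frame_trT *m (w - w^T).
Proof.
pose b := w - w^T; pose D i := G i - K i.
have bE i j : b i j = - b j i by rewrite !mxE; ring.
rewrite /trace_skew -/b mulmxDr opprD addrA; congr (_ - _).
under eq_bigr do rewrite mulmxDl linearD /= mul_scalar_mx linearZ /=.
rewrite big_split /= -scaler_sumr -frame_trTE mul_mx_scalar addrAC subrr add0r.
have rowb i : row i (b *m (G i - K i)) = \sum_j b i j *: row j (D i).
  rewrite row_mul mulmx_sum_row; apply: eq_bigr => j _.
  by rewrite mxE.
under eq_bigr do rewrite rowb.
have -> : \sum_i \sum_j (2^-1 * b i j) *: frame_torsion i j =
    2^-1 *: \sum_i \sum_j b i j *: row j (D i)
    - 2^-1 *: \sum_i \sum_j b i j *: row i (D j).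
  rewrite -scalerBr -sumrB scaler_sumr; apply: eq_bigr => i _.
  rewrite -sumrB scaler_sumr; apply: eq_bigr => j _.
  by rewrite -scalerBr scalerA.
rewrite [X in _ - 2^-1 *: X]exchange_big /=.
have -> : \sum_j \sum_i b i j *: row i (D j) = - \sum_j \sum_i b j i *: row i (D j).
  rewrite -sumrN; apply: eq_bigr => j _; rewrite -sumrN; apply: eq_bigr => i _.
  by rewrite bE scaleNr.
have half : 2^-1 + 2^-1 = 1 :> R by lra.
by rewrite scalerN opprK -scalerDl half scale1r.
Qed.

Lemma frame_div_shape_change : frame_div G (trace_skew w) (fun i => trace_skew (dw i)) =
  frame_div K (trace_skew w) (fun i => trace_skew (dw i)) - frame_trT *m (w - w^T) +
  \sum_i \sum_j (2^-1 * (w - w^T) i j) *: frame_torsion i j.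
Proof. by rewrite frame_div_change -addrA frame_trTWa addrA addrAC. Qed.

End FrameAlgebra.

(** * Orthonormal frames of the hypersurface *)

Lemma smooth_section_eq {R : realType} {m k : nat} {M : manifold R m} {P : manifold R k}
    (F : M -> P) (sF : smooth_map F) (U : set M) s t : open U ->
  (forall q, U q -> s q = t q) -> smooth_section F U s -> smooth_section F U t.
Proof.
move=> oU st ss c d j; have oi := section_domain_open sF c d oU.
apply: (Ck_eq oi _ (ss c d j)) => x /section_domainP[cx Ux dx xK].
by rewrite st.
Qed.

(** Coefficients relative to a smooth frame are smooth, as they are obtained from the
    components by the inverse of the matrix of the frame. *)
Lemma frame_coef_smooth {R : realType} {m a : nat} {M : manifold R m} (U : set M)
    (E : 'I_m -> M -> 'rV[R]_m) (f : M -> 'M[R]_(a, m)) :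
  open U -> (forall i, vector_field U (E i)) ->
  (forall q, U q -> \matrix_i E i q \in unitmx) ->
  (forall i, vector_field U (fun q => row i (f q) *m \matrix_j E j q)) ->
  smooth_fun U f.
Proof.
move=> oU sE uE sf c k; have oi := chart_image_open c oU.
pose rep (b : nat) (X : 'I_b -> M -> 'rV[R]_m) x : 'M[R]_(b, m) :=
  \matrix_i components c (chart_param c x) (X i (chart_param c x)).
have rep_smooth b (X : 'I_b -> M -> 'rV[R]_m) : (forall i, vector_field U (X i)) ->
    Ck k (chart_coord c @` (chart_dom c `&` U)) (rep b X).
  move=> sX; apply/Ck_mxP => // i j.
  have /(Ck_mxP _ _ oi) h := vector_field_components c oU (sX i) k.
  by apply: Ck_eq (h 0 j) => // x _; rewrite mxE.
have comp_mul x u : chart_dom c (chart_param c x) ->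
    components c (chart_param c x) (u *m \matrix_j E j (chart_param c x)) = u *m rep m E x.
  move=> cx; rewrite !mulmx_sum_row (linear_fun_sum _ _ _ (components_linear cx)).
  by apply: eq_bigr => i _; rewrite !rowK.
have rep_unit x : (chart_coord c @` (chart_dom c `&` U)) x -> rep m E x \in unitmx.
  move=> /chart_imageP[cx Ux _]; apply: unitmx_of_inj => u; rewrite -comp_mul // => u0.
  have := componentsK (u *m \matrix_j E j (chart_param c x)) cx.
  rewrite u0 (linear_fun0 (vector_of_linear cx)) => uE0.
  by rewrite -[u](mulmxK (uE _ Ux)) -uE0 mul0mx.
apply: (Ck_eq (f := fun x =>
  rep a (fun i q => row i (f q) *m \matrix_j E j q) x *m invmx (rep m E x))) => //.
  move=> x ix; have [cx Ux _] := chart_imageP ix.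
  apply: (canLR (mulmxK (rep_unit x ix))); apply/row_matrixP => i.
  by rewrite rowK comp_mul // row_mul.
by apply: Ck_mulmx => //; [exact: rep_smooth|apply: Ck_invmx => //; exact: rep_smooth].
Qed.

Lemma entry_smooth {R : realType} {m a b : nat} {M : manifold R m} (U : set M)
    (f : M -> 'M[R]_(a, b)) i j :
  open U -> smooth_fun U f -> smooth_fun U (fun q => f q i j : R).
Proof.
move=> oU sf c k; have oi := chart_image_open c oU.
by have /(Ck_mxP _ _ oi) h := sf c k; exact: h.
Qed.

Lemma der_entry {R : realType} {m a b : nat} {M : manifold R m}
    (f : M -> 'M[R]_(a, b)) i j p v : differentiable_at f p ->
  der (fun q => f q i j : R) p v = (der f p v) i j.
Proof.
by move=> df; have [_ e] := is_derive_mx_entry i j (is_derive_der v df); rewrite -e.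
Qed.

Lemma trace_skewE {R : realFieldType} {n : nat} (x : 'M[R]_n) i j :
  trace_skew x i j = \sum_l (i == j)%:R * x l l + (x i j - x j i).
Proof. by rewrite /trace_skew !mxE -mulr_sumr mulr_natl. Qed.

Lemma trace_skew_smooth {R : realType} {m a : nat} {M : manifold R m} (U : set M)
    (f : M -> 'M[R]_a) : open U -> smooth_fun U f -> smooth_fun U (fun q => trace_skew (f q)).
Proof.
move=> oU sf c k; have oi := chart_image_open c oU.
have fij i j : Ck k (chart_coord c @` (chart_dom c `&` U))
    (fun x => f (chart_param c x) i j : R) by exact: entry_smooth.
apply/Ck_mxP => // i j.
apply: (Ck_eq (V := R) (f := fun x => \sum_l (i == j)%:R * f (chart_param c x) l l +
  (f (chart_param c x) i j + (- 1) * f (chart_param c x) j i))) => //.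
  by move=> x _; rewrite /= trace_skewE mulN1r.
apply: CkD => //.
  by apply: Ck_sum => // l _; apply: CkM => //; exact: Ck_cst.
by apply: CkD => //; apply: CkM => //; exact: Ck_cst.
Qed.

Lemma der_trace_skew {R : realType} {m a : nat} {M : manifold R m} (f : M -> 'M[R]_a) p v :
  differentiable_at f p -> der (fun q => trace_skew (f q)) p v = trace_skew (der f p v).
Proof.
move=> df; have D i j := is_derive_mx_entry i j (is_derive_der v df).
set x0 := chart_coord _ _ in D; set S := f \o _ in D.
suff [_ e] : is_derive x0 v (fun z => trace_skew (S z)) (trace_skew (der f p v)) by exact: e.
apply: is_derive_mx => i j.
have -> : (fun z => trace_skew (S z) i j : R) =
    (\sum_l ((i == j)%:R \*: (fun z => S z l l : R)))
    + ((fun z => S z i j : R) - (fun z => S z j i : R)).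
  by apply/funext => z; rewrite trace_skewE !fctE fct_sumE.
rewrite trace_skewE.
exact: (is_deriveD (is_derive_sum (fun l => is_deriveZ (i == j)%:R (D l l)))
  (is_deriveB (D i j) (D j i))).
Qed.

Section OrthonormalFrame.
Context {R : realType} {n : nat} {Mt : weitzenbock R n} {M : hypersurface Mt}.
Local Notation met := (@hmetric R n Mt M).
Variables (U : set M) (oU : open U) (E : 'I_n -> M -> 'rV[R]_n).
Hypothesis hE : orthonormal_frame met U E.

Definition frame_rows q : 'M[R]_n := \matrix_i E i q.

Lemma hmetric_gram q u v : met q u v = (u *m gram met q *m v^T) 0 0.
Proof. by rewrite hmetricE gramE /dot trmx_mul !mulmxA. Qed.

Lemma frame_rows_orthonormal q : U q ->
  frame_rows q *m gram met q *m (frame_rows q)^T = 1%:M.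
Proof.
move=> Uq; have [_ on] := hE; apply/matrixP => i j.
rewrite [RHS]mxE -(on q Uq i j) hmetric_gram.
have -> : E i q = row i (frame_rows q) by rewrite rowK.
have -> : E j q = row j (frame_rows q) by rewrite rowK.
by rewrite -row_mul [LHS]mxE [RHS]mxE; apply: eq_bigr => k _; rewrite [row i _ _ _]mxE !mxE.
Qed.

Lemma frame_rows_unit q : U q -> frame_rows q \in unitmx.
Proof.
by move=> /frame_rows_orthonormal; rewrite -mulmxA => /mulmx1_unit[].
Qed.

Lemma frame_rows_inv q : U q -> gram met q *m (frame_rows q)^T *m frame_rows q = 1%:M.
Proof. by move=> /frame_rows_orthonormal; rewrite -mulmxA => /mulmx1C. Qed.

Lemma frame_coord q v : U q ->
  v = (\row_l met q v (E l q)) *m frame_rows q.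
Proof.
move=> Uq; rewrite -{1}[v]mulmx1 -(frame_rows_inv Uq) !mulmxA; congr (_ *m _).
apply/rowP => l; rewrite [RHS]mxE hmetric_gram !mxE; apply: eq_bigr => k _.
by rewrite !mxE.
Qed.

(** On [U] the inverse of [frame_rows q] is [gram met q *m (frame_rows q)^T], see
    [frame_rows_inv]; hence this is the matrix of [A] in the frame. *)
Definition frame_rep q (A : 'M[R]_n) : 'M[R]_n :=
  frame_rows q *m A *m gram met q *m (frame_rows q)^T.

Lemma frame_repE q A : U q -> frame_rows q *m A = frame_rep q A *m frame_rows q.
Proof.
move=> Uq; rewrite /frame_rep -!mulmxA [gram _ _ *m _]mulmxA frame_rows_inv //.
by rewrite mulmx1.
Qed.

Lemma frame_rep_tr q A : U q -> \tr (frame_rep q A) = \tr A.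
Proof.
move=> Uq; rewrite /frame_rep -!mulmxA mxtrace_mulC -!mulmxA.
by rewrite [gram _ _ *m _]mulmxA frame_rows_inv // mulmx1.
Qed.

(** In an orthonormal frame the adjoint is the transpose. *)
Lemma frame_rep_adjoint q A : U q -> frame_rep q (adjoint met q A) = (frame_rep q A)^T.
Proof.
move=> Uq; have Gt : (gram met q)^T = gram met q.
  by rewrite gramE trmx_mul trmxK.
rewrite /frame_rep /adjoint !trmx_mul trmxK Gt !mulmxA mulmxKV //.
exact: gram_unit.
Qed.

Lemma frame_rows_adjoint q A : U q ->
  frame_rows q *m adjoint met q A = (frame_rep q A)^T *m frame_rows q.
Proof. by move=> Uq; rewrite frame_repE // frame_rep_adjoint. Qed.

Lemma frame_rows_skew q A : U q ->
  frame_rows q *m (2 *: skew_part q A) =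
  (frame_rep q A - (frame_rep q A)^T) *m frame_rows q.
Proof.
move=> Uq; rewrite /skew_part scalerA mulfV ?scale1r ?pnatr_eq0 //.
by rewrite mulmxBr mulmxBl frame_rows_adjoint // frame_repE.
Qed.

Lemma frame_rows_trace_skew q A : U q ->
  frame_rows q *m ((\tr A)%:M + 2 *: skew_part q A) =
  trace_skew (frame_rep q A) *m frame_rows q.
Proof.
move=> Uq; rewrite mulmxDr frame_rows_skew // mul_mx_scalar /trace_skew [RHS]mulmxDl.
by rewrite frame_rep_tr // mul_scalar_mx.
Qed.

Lemma sharp_frame q (a : 'rV[R]_n -> R) : U q ->
  (forall c u v, a (c *: u + v) = c * a u + a v) ->
  sharp met q a = (\row_i a (E i q)) *m frame_rows q.
Proof.
move=> Uq la.
have BB : invmx (gram met q) = (frame_rows q)^T *m frame_rows q.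
  by rewrite -[LHS]mulmx1 -(frame_rows_inv Uq) !mulmxA mulVmx ?gram_unit // mul1mx.
rewrite /sharp BB mulmxA; congr (_ *m _); apply/rowP => i; rewrite !mxE.
have a0 : a 0 = 0.
  have := la (-1) 0 0; rewrite scaler0 addr0 => e.
  by rewrite e mulN1r addNr.
rewrite [E i q]row_sum_delta; symmetry.
elim: (index_enum 'I_n) => [|k r IH]; first by rewrite !big_nil.
by rewrite !big_cons la IH !mxE mulrC.
Qed.

Lemma tr12_linear (P : 'rV[R]_n -> 'rV[R]_n -> 'rV[R]_n) :
  (forall y, linear (P ^~ y)) ->
  forall c u v, tr12 P (c *: u + v) = c * tr12 P u + tr12 P v.
Proof.
move=> lP c u v; rewrite /tr12 /mxtrace mulr_sumr -big_split; apply: eq_bigr => i _.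
by rewrite /= !mxE lP !mxE.
Qed.

Lemma tr12_frame q (P : 'rV[R]_n -> 'rV[R]_n -> 'rV[R]_n) x (c : 'I_n -> 'rV[R]_n) :
  U q -> linear (P x) -> (forall j, P x (E j q) = c j *m frame_rows q) ->
  tr12 P x = \sum_j c j 0 j.
Proof.
move=> Uq lP Pc; rewrite /tr12 -(frame_rep_tr _ Uq).
pose L := GRing.isLinear.Build _ _ _ _ _ lP.
pose PL : {linear 'rV[R]_n -> 'rV[R]_n} := HB.pack (P x) L.
rewrite /mxtrace; apply: eq_bigr => j _.
have e : row j (frame_rep q (lin1_mx (P x))) *m frame_rows q = c j *m frame_rows q.
  rewrite -row_mul -frame_repE // row_mul rowK -Pc.
  exact: (mul_rV_lin1 PL).
have {}e := can_inj (mulmxK (frame_rows_unit Uq)) e.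
by rewrite -e [RHS]mxE.
Qed.

End OrthonormalFrame.

Section FrameConnections.
Context {R : realType} {n : nat} {Mt : weitzenbock R n} {M : hypersurface Mt}.
Local Notation met := (@hmetric R n Mt M).
Variables (U : set M) (oU : open U) (E : 'I_n -> M -> 'rV[R]_n).
Hypothesis hE : orthonormal_frame met U E.

Local Notation B := (frame_rows E).

Lemma frame_near p i : U p -> field_near p (E i).
Proof. by move=> Up; exists U; [exact: conj oU Up|have [sE _] := hE; exact: sE]. Qed.

Lemma row_frame_sum q (f : 'M[R]_n) j : row j f *m B q = \sum_l f j l *: E l q.
Proof. by rewrite mulmx_sum_row; apply: eq_bigr => l _; rewrite mxE rowK. Qed.

Lemma row_frame_rows i q : row i (B q) = E i q.
Proof. by rewrite rowK. Qed.

Lemma frame_rep_smooth A : tensor11 A -> smooth_fun U (fun q => frame_rep E q (A q)).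
Proof.
move=> tA; have [sE _] := hE; apply: (frame_coef_smooth (E := E)) => // [q Uq|i].
  exact: (frame_rows_unit hE Uq).
apply: (smooth_section_eq (@id_smooth_map R n M) (s := fun q => E i q *m A q)) => //.
  move=> q Uq; rewrite -/(B q) -row_mul -(frame_repE hE) // row_mul.
  by rewrite row_frame_rows.
exact: tA.
Qed.

Section Expansion.
Variables (p : M) (Up : U p).
Variable D : (M -> 'rV[R]_n) -> M -> 'rV[R]_n -> 'rV[R]_n.

(** The coefficients of a connection in the frame; skew if it is metric, as the
    scalar products of the frame are constant. *)
Definition connection_mx k : 'M[R]_n :=
  \matrix_(j, l) met p (D (E j) p (E k p)) (E l p).

Lemma connection_mxE j k : D (E j) p (E k p) = row j (connection_mx k) *m B p.
Proof.
rewrite [LHS](frame_coord hE _ Up); congr (_ *m _).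
by apply/rowP => l; rewrite !mxE.
Qed.

Lemma connection_mx_skew :
  (forall v i j, der (fun q => met q (E i q) (E j q)) p v =
    met p (D (E i) p v) (E j p) + met p (E i p) (D (E j) p v)) ->
  forall k, (connection_mx k)^T = - connection_mx k.
Proof.
move=> compat k; apply/matrixP => i j; rewrite !mxE.
have [_ on] := hE; have := compat (E k p) j i.
have nU : \forall q \near p, met q (E j q) (E i q) = (j == i)%:R.
  by apply: filterS (open_nbhs_nbhs (conj oU Up)) => q Uq; exact: on.
rewrite (der_locally_cst _ nU).
have symm u v : met p u v = met p v u by rewrite !hmetricE dotC.
rewrite [met p (E j p) _]symm => e; apply/eqP; rewrite -addr_eq0; apply/eqP.
exact/esym.
Qed.

Hypothesis Dexpand : forall v t (f : 'I_n -> M -> R) (s : 'I_n -> M -> 'rV[R]_n),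
  field_near p t -> (forall i, fun_near p (f i)) -> (forall i, field_near p (s i)) ->
  (\forall q \near p, t q = \sum_i f i q *: s i q) ->
  D t p v = \sum_i (der (f i) p v *: s i p + f i p *: D (s i) p v).

Variables (A f : M -> 'M[R]_n) (sf : smooth_fun U f).
Hypothesis Af : forall q, U q -> B q *m A q = f q *m B q.

(** The hypothesis [Dexpand] covers both [nabla], which is given by a formula, and the
    Levi-Civita connection, which is given by its axioms. *)
Lemma connection_frame j k : D (fun q => E j q *m A q) p (E k p) =
  row j (der f p (E k p) + f p *m connection_mx k) *m B p.
Proof.
have df : differentiable_at f p by exact: smooth_fun_differentiable_at Up.
have nf l : fun_near p (fun q => f q j l : R).
  by exists U; [exact: conj oU Up|exact: entry_smooth].
have EA q : U q -> E j q *m A q = \sum_l f q j l *: E l q.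
  by move=> Uq; rewrite -row_frame_sum -row_mul -Af // row_mul row_frame_rows.
have [sE _] := hE.
have nt : field_near p (fun q => E j q *m A q).
  have [V [oV Vp] sV] := section_near_sum (@id_smooth_map R n M) (index_enum 'I_n)
    (fun l => section_nearZ (@id_smooth_map R n M) (nf l) (frame_near l Up)).
  exists (U `&` V); first by split=> //; exact: openI.
  apply: (smooth_section_eq (@id_smooth_map R n M) (openI oU oV) _
    (smooth_section_sub (@subIsetr _ U V) sV)).
  by move=> q [Uq _]; rewrite EA.
have near_EA : \forall q \near p, E j q *m A q = \sum_l f q j l *: E l q.
  by apply: filterS (open_nbhs_nbhs (conj oU Up)) => q Uq; exact: EA.
rewrite (Dexpand _ nt nf (fun l => frame_near l Up) near_EA).
have -> : row j (der f p (E k p) + f p *m connection_mx k) =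
    row j (der f p (E k p)) + row j (f p) *m connection_mx k.
  by rewrite -row_mul; apply/rowP => l; rewrite !mxE.
rewrite mulmxDl row_frame_sum -mulmxA mulmx_sum_row -big_split /=.
apply: eq_bigr => l _; rewrite der_entry // [row j (f p) 0 l]mxE; congr (_ + _ *: _).
by rewrite connection_mxE row_mul.
Qed.

Lemma divergence_frame : divergence E D A p =
  frame_div connection_mx (f p) (fun i => der f p (E i p)) *m B p.
Proof.
rewrite /divergence /frame_div mulmx_suml; apply: eq_bigr => i _.
by rewrite connection_frame connection_mxE -mulmxA Af // mulmxA -mulmxBl.
Qed.

End Expansion.
End FrameConnections.

(** * The Laplacian of the Gauss map *)

Theorem theorem3p5 (R : realType) (n : nat)
    (Mt : weitzenbock R n) (M : hypersurface Mt)
    (N : M -> 'rV[R]_n.+1) (hN : unit_normal N)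
    (W : M -> 'M[R]_n) (hW : weingarten N W)
    (T : M -> 'rV[R]_n -> 'rV[R]_n -> 'rV[R]_n) (hT : torsion_tensor T)
    (nablabar : (M -> 'rV[R]_n) -> M -> 'rV[R]_n -> 'rV[R]_n)
    (hnablabar : levi_civita (@hmetric R n Mt M) nablabar)
    (Sn : sphere R n)
    (nablaSn : (Sn -> 'rV[R]_n) -> Sn -> 'rV[R]_n -> 'rV[R]_n)
    (hnablaSn : levi_civita (@round_metric R n Sn) nablaSn)
    (g : M -> Sn) (hg : gauss_map N g)
    (nablag : (M -> 'rV[R]_n) -> M -> 'rV[R]_n -> 'rV[R]_n)
    (hnablag : pullback_connection g nablaSn nablag)
    (phi : M -> 'M[R]_n) (hphi : identification g phi)
    (U : set M) (hU : open U)
    (E : 'I_n -> M -> 'rV[R]_n)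
    (hE : orthonormal_frame (@hmetric R n Mt M) U E)
    (p : M) (hp : U p) :
  let Wa := fun q => skew_part q (W q) in
  let A := fun q => (\tr (W q))%:M + 2 *: Wa q in
  let div := divergence E (@nabla R n Mt M) A p in
  let divbar := divergence E nablabar A p in
  let lap := laplacian E g nablag (@nabla R n Mt M) p in
  let lapbar := laplacian E g nablag nablabar p in
  let trWT := sharp (@hmetric R n Mt M) p
                (tr12 (fun x y => T p x y *m W p)) in
  let trT := sharp (@hmetric R n Mt M) p (tr12 (T p)) in
  let trTWa := \sum_i T p (E i p) (E i p *m Wa p) in
  [/\ - (lap *m invmx (phi p)) = div + trWT,
      - (lap *m invmx (phi p)) = divbar + trWT - 2 *: (trT *m Wa p) + trTWa,
      - (lapbar *m invmx (phi p)) = div + trWT + trT *m W p,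
      - (lapbar *m invmx (phi p)) =
        divbar + trWT + trT *m adjoint (@hmetric R n Mt M) p (W p) + trTWa &
      (forall q x y, T q x y = 0) -> - (lap *m invmx (phi p)) = div].
Proof.
move=> Wa A div divbar lap lapbar trWT trT trTWa.
have [tW _] := hW; have [[Tlin1 Tlin2 _] TE] := hT; have [sE _] := hE.
have [cbar compatbar tfbar] := hnablabar.
pose B := frame_rows E p.
pose f q := frame_rep E q (W q).
have sf : smooth_fun U f by exact: (frame_rep_smooth hU hE tW).
have df : differentiable_at f p by exact: (smooth_fun_differentiable_at sf hp).
have fW q : U q -> frame_rows E q *m W q = f q *m frame_rows E q.
  exact: (frame_repE hE).
have sh : smooth_fun U (fun q => trace_skew (f q)) by exact: trace_skew_smooth.
have hA q : U q -> frame_rows E q *m A q = trace_skew (f q) *m frame_rows E q.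
  exact: (frame_rows_trace_skew hE).
pose G := connection_mx E p (@nabla R n Mt M).
pose K := connection_mx E p nablabar.
pose w := f p; pose dw i := der f p (E i p).
have nE i : field_near p (E i) := frame_near hU hE i hp.
have skewG k : (G k)^T = - G k.
  apply: (connection_mx_skew hU hE hp) => v i j; exact: nabla_metric.
have skewK k : (K k)^T = - K k.
  by apply: (connection_mx_skew hU hE hp) => v i j; exact: compatbar.
have GE j k : nabla (E j) p (E k p) = row j (G k) *m B := connection_mxE hE hp _ j k.
have KE j k : nablabar (E j) p (E k p) = row j (K k) *m B :=
  connection_mxE hE hp _ j k.
have expG v t (c : 'I_n -> M -> R) (s : 'I_n -> M -> 'rV[R]_n) :
    field_near p t -> (forall i, fun_near p (c i)) -> (forall i, field_near p (s i)) ->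
    (\forall q \near p, t q = \sum_i c i q *: s i q) ->
    nabla t p v = \sum_i (der (c i) p v *: s i p + c i p *: nabla (s i) p v).
  by move=> _; exact: nabla_expand.
have expK v t (c : 'I_n -> M -> R) (s : 'I_n -> M -> 'rV[R]_n) :
    field_near p t -> (forall i, fun_near p (c i)) -> (forall i, field_near p (s i)) ->
    (\forall q \near p, t q = \sum_i c i q *: s i q) ->
    nablabar t p v = \sum_i (der (c i) p v *: s i p + c i p *: nablabar (s i) p v).
  exact: (connection_expand (@id_smooth_map R n M) cbar).
have WE j k : nabla (fun q => E j q *m W q) p (E k p) = row j (dw k + w *m G k) *m B.
  exact: (connection_frame hU hE hp expG sf fW).
have dh i : der (fun q => trace_skew (f q)) p (E i p) = trace_skew (dw i).
  by exact: der_trace_skew.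
have divE : div = frame_div G (trace_skew w) (fun i => trace_skew (dw i)) *m B.
  rewrite /div (divergence_frame hU hE hp expG sh hA); congr (_ *m _).
  by apply: eq_bigr => i _; rewrite dh.
have divbarE : divbar = frame_div K (trace_skew w) (fun i => trace_skew (dw i)) *m B.
  rewrite /divbar (divergence_frame hU hE hp expK sh hA); congr (_ *m _).
  by apply: eq_bigr => i _; rewrite dh.
(* The Levi-Civita connection has no torsion, so it gives the bracket. *)
have lieE k j : lie (E k) (E j) p = (row j (K k) - row k (K j)) *m B.
  have := tfbar _ _ p (nE k) (nE j); rewrite /torsion !KE => /eqP.
  by rewrite subr_eq0 mulmxBl => /eqP.
have TFE k j : T p (E k p) (E j p) = frame_torsion G K k j *m B.
  by rewrite frame_torsionE (TE _ _ p (nE k) (nE j)) /torsion !GE lieE -!mulmxBl.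
have fWp : B *m W p = w *m B := fW p hp.
have uB : B \in unitmx := frame_rows_unit hE hp.
have codG k j : row j (dw k + w *m G k) - row k (dw j + w *m G j) =
    (row j (K k) - row k (K j)) *m w.
  have e := codazzi hN hW hg hU hp (sE k) (sE j).
  apply: (can_inj (mulmxK uB)); apply: etrans (mulmxBl _ _ _) _.
  apply: etrans (esym (congr2 (fun u v => u - v) (WE j k) (WE k j))) _.
  by apply: etrans e _; rewrite lieE -mulmxA fWp mulmxA.
have lapE : - (lap *m invmx (phi p)) = frame_div G w dw *m B.
  rewrite (laplacian_gauss hN hW hg hnablaSn hnablag hphi _ hU hp sE).
  rewrite /frame_div mulmx_suml; apply: eq_bigr => i _.
  by rewrite WE GE -mulmxA fWp mulmxA -mulmxBl.
have lapbarE : - (lapbar *m invmx (phi p)) =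
    (frame_div G w dw + frame_trT G K *m w) *m B.
  rewrite (laplacian_gauss hN hW hg hnablaSn hnablag hphi _ hU hp sE).
  rewrite (frame_trTE skewG skewK) /frame_div mulmx_suml -big_split mulmx_suml.
  apply: eq_bigr => i _ /=.
  have e : row i (dw i + w *m G i) - row i (K i) *m w =
      row i (dw i + w *m G i) - row i (G i) *m w + row i (G i - K i) *m w.
    by rewrite row_sub mulmxBl addrA subrK.
  apply: etrans _ (congr1 (fun r => r *m B) e).
  by rewrite WE KE -mulmxA fWp mulmxA -mulmxBl.
have trTE : trT = frame_trT G K *m B.
  rewrite /trT (sharp_frame hE hp); last exact: tr12_linear.
  congr (_ *m _); apply/rowP => m; rewrite !mxE.
  by apply: (tr12_frame hE hp) => // j; rewrite TFE.
have trWTE : trWT = frame_trWT G K w *m B.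
  rewrite /trWT (sharp_frame hE hp); last first.
    by apply: tr12_linear => y c u v; rewrite Tlin2 mulmxDl scalemxAl.
  congr (_ *m _); apply/rowP => m; rewrite !mxE.
  apply: (tr12_frame hE hp) => [|j].
    by move=> c u v; rewrite Tlin1 mulmxDl scalemxAl.
  by rewrite TFE -mulmxA fWp mulmxA.
have BWa : 2 *: (B *m Wa p) = (w - w^T) *m B.
  by rewrite scalemxAr (frame_rows_skew hE).
have trTWaE : trTWa =
    (\sum_i \sum_j (2^-1 * (w - w^T) i j) *: frame_torsion G K i j) *m B.
  rewrite /trTWa mulmx_suml; apply: eq_bigr => i _.
  have -> : E i p *m Wa p = \sum_j (2^-1 * (w - w^T) i j) *: E j p.
    rewrite -(row_frame_rows E i p) -row_mul.
    have -> : frame_rows E p *m Wa p = (2^-1 *: (w - w^T)) *m B.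
      by rewrite -scalemxAl -BWa scalerA mulVf ?scale1r ?pnatr_eq0.
    by rewrite row_mul row_frame_sum; apply: eq_bigr => j _; rewrite mxE.
  rewrite (linear_fun_sum _ _ _ (Tlin1 p _)) mulmx_suml; apply: eq_bigr => j _.
  by rewrite TFE scalemxAl.
have F1 := frame_div_shape skewG codG.
have F2 := frame_div_shape_change dw w skewG skewK.
have trTW : trT *m W p = (frame_trT G K *m w) *m B by rewrite trTE -[LHS]mulmxA fWp mulmxA.
have trTWt : trT *m adjoint (@hmetric R n Mt M) p (W p) = (frame_trT G K *m w^T) *m B.
  by rewrite trTE -[LHS]mulmxA (frame_rows_adjoint hE) // mulmxA.
have trTWa2 : 2 *: (trT *m Wa p) = (frame_trT G K *m (w - w^T)) *m B.
  by rewrite trTE -[X in 2 *: X]mulmxA scalemxAr BWa mulmxA.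
have trWT0 : (forall q x y, T q x y = 0) -> trWT = 0.
  move=> T0; rewrite /trWT /sharp.
  have -> : tr12 (fun x y => T p x y *m W p) = fun=> 0.
    apply/funext => x; rewrite /tr12 /mxtrace big1 // => i _.
    by rewrite mxE T0 mul0mx mxE.
  have -> : (\row_i 0 : 'rV[R]_n) = 0 by apply/rowP => i; rewrite !mxE.
  by rewrite mul0mx.
(* From here on only the coordinate expressions matter. *)
clearbody lap lapbar div divbar trWT trT trTWa G K dw w B.
have lap_div : - (lap *m invmx (phi p)) = div + trWT.
  by rewrite lapE divE trWTE -mulmxDl F1.
have lap_lapbar : - (lapbar *m invmx (phi p)) = - (lap *m invmx (phi p)) + trT *m W p.
  by rewrite lapbarE lapE trTW -mulmxDl.
have div_divbar : div = divbar - 2 *: (trT *m Wa p) + trTWa.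
  by rewrite divE divbarE trTWa2 trTWaE -mulmxBl -mulmxDl F2.
have WaE : 2 *: (trT *m Wa p) = trT *m W p - trT *m adjoint (@hmetric R n Mt M) p (W p).
  by rewrite trTWa2 trTW trTWt -mulmxBl mulmxBr.
clear - lap_div lap_lapbar div_divbar WaE trWT0.
rewrite lap_lapbar {lap_lapbar} lap_div div_divbar WaE {lap_div div_divbar WaE}.
move: (trT *m W p) (trT *m adjoint _ _ _) => x y.
split=> //.
- by apply/rowP => i; rewrite !mxE; ring.
- by apply/rowP => i; rewrite !mxE; ring.
- by move=> /trWT0 ->; rewrite addr0.
Qed.
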